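(* For any family (sequence) $(X_t^{(n)})_{n\ge1}$ of irreducible continuous-time birth-and-death chains, cutoff in worst-case total-variation distance is equivalent to cutoff in worst-case separation: one has $\lim_{n\to\infty}t_{\mathrm{mix}}^{(n)}(\epsilon)/t_{\mathrm{mix}}^{(n)}(1-\epsilon)=1$ for every $0<\epsilon<1$ if and only if $\lim_{n\to\infty}t_{\mathrm{sep}}^{(n)}(\epsilon)/t_{\mathrm{sep}}^{(n)}(1-\epsilon)=1$ for every $0<\epsilon<1$.
   Context: A continuous-time birth-and-death chain has state space $\Omega=\{0,\ldots,N\}$ for some integer $N\ge1$ (which may differ from chain to chain) and heat kernel $H_t(x,y)=\mathbb P_x(X_t=y)$, $H_t=\mathrm e^{t(P-I)}$ for real $t\ge0$, where $P$ is a stochastic matrix on $\Omega$ with $P(x,y)=0$ whenever $|x-y|>1$ (no laziness assumed); it is irreducible if $P$ is. Let $\pi$ be the stationary distribution. With $\|\mu-\nu\|_{\mathrm{TV}}=\frac12\sum_x|\mu(x)-\nu(x)|$, put $t_{\mathrm{mix}}(\epsilon)=\min\{t\ge0:\max_{x}\|H_t(x,\cdot)-\pi\|_{\mathrm{TV}}\le\epsilon\}$. The separation of $\mu$ from $\nu$ is $\mathrm{sep}(\mu,\nu)=\sup_{x\in\Omega}\big(1-\mu(x)/\nu(x)\big)$, and $t_{\mathrm{sep}}(\epsilon)=\min\{t\ge0:\max_x\mathrm{sep}(H_t(x,\cdot),\pi)\le\epsilon\}$. A superscript $(n)$ indicates the quantity for the $n$-th chain. *)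

(* Defs.v *)
From HB Require Import structures.
From mathcomp Require Import all_boot all_order all_algebra.
From mathcomp Require Import all_classical all_reals all_analysis.
Set Implicit Arguments.
Unset Strict Implicit.
Unset Printing Implicit Defensive.
Import Order.TTheory GRing.Theory Num.Theory.
Import numFieldNormedType.Exports.
Local Open Scope classical_set_scope.
Local Open Scope ring_scope.

(* The state space {0, ..., N} is 'I_N.+1; distributions on it are row vectors
   and P i j is the probability of a jump from i to j. *)

Definition stochastic (R : realType) (N : nat) (P : 'M[R]_N.+1) : Prop :=
  (forall x y, 0 <= P x y) /\ (forall x, \sum_y P x y = 1).

Definition nearest_neighbour (R : realType) (N : nat) (P : 'M[R]_N.+1) : Prop :=
  forall x y : 'I_N.+1, ((x.+1 < y) || (y.+1 < x))%N -> P x y = 0.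

Definition irreducible (R : realType) (N : nat) (P : 'M[R]_N.+1) : Prop :=
  forall x y, exists k : nat, 0 < (P ^+ k) x y.

Definition irreducible_birth_death (R : realType) (N : nat) (P : 'M[R]_N.+1) :
    Prop :=
  [/\ stochastic P, nearest_neighbour P & irreducible P].

Definition stationary_distribution (R : realType) (N : nat)
    (P : 'M[R]_N.+1) (pi : 'rV[R]_N.+1) : Prop :=
  [/\ forall x, 0 <= pi 0 x, \sum_x pi 0 x = 1 & pi *m P = pi].

(* The exponential series sum_k A^k / k!, summed entrywise. *)
Definition mxexp (R : realType) (N : nat) (A : 'M[R]_N.+1) : 'M[R]_N.+1 :=
  \matrix_(i, j) limn (series (fun k : nat => (A ^+ k) i j / k`!%:R)).

Definition heat_kernel (R : realType) (N : nat) (P : 'M[R]_N.+1) (t : R) :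
    'M[R]_N.+1 :=
  mxexp (t *: (P - 1%:M)).

(* Taking f ord0 as the initial value gives the true maximum of f over the
   nonempty finite state space, whatever the signs of its values. *)
Definition max_state (R : realType) (N : nat) (f : 'I_N.+1 -> R) : R :=
  \big[Num.max/f ord0]_(x < N.+1) f x.

Definition tv_distance (R : realType) (N : nat) (mu nu : 'rV[R]_N.+1) : R :=
  2^-1 * \sum_x `|mu 0 x - nu 0 x|.

Definition separation (R : realType) (N : nat) (mu nu : 'rV[R]_N.+1) : R :=
  max_state (fun x => 1 - mu 0 x / nu 0 x).

(* The minimum of the set of times is rendered as its infimum: for an
   irreducible chain and eps > 0 the set is nonempty, and it is closed since
   the distances are continuous in t, so the infimum is attained. *)
Definition t_mix (R : realType) (N : nat) (P : 'M[R]_N.+1) (pi : 'rV[R]_N.+1)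
    (eps : R) : R :=
  inf [set t : R | 0 <= t /\
    max_state (fun x => tv_distance (row x (heat_kernel P t)) pi) <= eps].

Definition t_sep (R : realType) (N : nat) (P : 'M[R]_N.+1) (pi : 'rV[R]_N.+1)
    (eps : R) : R :=
  inf [set t : R | 0 <= t /\
    max_state (fun x => separation (row x (heat_kernel P t)) pi) <= eps].

(* T n eps is the eps-mixing time of the n-th chain.  A ratio with zero
   denominator evaluates to 0, so the limit 1 forces T n (1 - eps) to be nonzero
   for all large n. *)
Definition cutoff (R : realType) (T : nat -> R -> R) : Prop :=
  forall eps : R, 0 < eps < 1 ->
    (fun n : nat => T n eps / T n (1 - eps)) @ \oo --> (1 : R).

(* Main.v *)
(* Write F for the cumulative stationary distribution, r_k for the resistance of
   the edge (k, k+1), the inverse of pi_k P(k, k+1), and m for a median. The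
   Muckenhoupt constant
   B = max_(i <= j) F(i) (1 - F(j)) (r_i + ... + r_j) plays the role of the
   relaxation time, T0 = sum_(k < m) r_k F(k) and TN = sum_(k >= m) r_k (1 - F(k))
   are the mean hitting times of m from the two ends, and T = T0 + TN >= B.
   Both cutoffs are equivalent to T / B -> oo.
   - The variance of the hitting time of a quantile x from 0 is O(B) times its
     mean, and replacing x by m changes the mean by O(B).
     Hence the chain started at 0 is mixed at time T0 + O(sqrt(B T)), and still
     sits on a set of small stationary mass at time T0 - O(sqrt(B T)).
   - By total positivity the chains started from the two ends control all the
     others: the total-variation mixing time is max(T0, TN) + O(sqrt(B T)) and
     the separation time is T0 + TN + O(sqrt(B T)). Thus T / B -> oo gives both
     cutoffs.
   - A test function attaining B shows that the distance at time K B is bounded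
     below by a constant depending on K only, so that cutoff at a time O(T)
     forces T / B -> oo. *)

Require Import Defs.
From HB Require Import structures.
From mathcomp Require Import all_boot all_order all_algebra.
From mathcomp Require Import all_classical all_reals all_analysis.
From mathcomp Require Import zify ring lra.
Set Implicit Arguments.
Unset Strict Implicit.
Unset Printing Implicit Defensive.
Import Order.TTheory GRing.Theory Num.Theory.
Import numFieldNormedType.Exports.
Local Open Scope classical_set_scope.
Local Open Scope ring_scope.

(** * Derivatives and the maximum principle *)

Section Calculus.
Variable R : realType.
Implicit Types (f g : R -> R) (t : R).

(** No probability space enters. The chain is its heat kernel, known through the backward equation,
    and each probabilistic step becomes a comparison for differential inequalities: stopping at [x]
    is a barrier on [[0, x)], the strong Markov property a bound supplied on [[x, N]], and
    Chebyshev's inequality an explicit supersolution. Continuous time is what makes total positivity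
    hold without laziness: two independent copies never jump at once, so they cannot exchange places
    without meeting. No eigenvalue is used either: [B] is explicit, and for the lower bound on
    mixing it suffices that [||H_s f||^2] is log-convex in [s], so that a slow initial decay stays
    slow for ever. For separation, the density at the pair of opposite ends is split at an
    intermediate time near [T0]; the chain from [0] is mixed or unmixed by then, and the remaining
    time plays the same role for the chain from [N]. Both distances finally fit one abstract scheme
    with the same [B] and [T]; it applies because [max(T0, TN)] lies between [T / 2] and [T]. *)

Lemma is_derive_add f g t df dg : is_derive t 1 f df -> is_derive t 1 g dg ->
  is_derive t 1 (fun s => f s + g s) (df + dg).
Proof. by move=> hf hg; exact: is_deriveD. Qed.

Lemma is_derive_sub f g t df dg : is_derive t 1 f df -> is_derive t 1 g dg ->
  is_derive t 1 (fun s => f s - g s) (df - dg).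
Proof. by move=> hf hg; exact: is_deriveB. Qed.

Lemma is_derive_mul f g t df dg : is_derive t 1 f df -> is_derive t 1 g dg ->
  is_derive t 1 (fun s => f s * g s) (df * g t + f t * dg).
Proof.
move=> hf hg; apply: (is_derive_eq (is_deriveM hf hg)).
by rewrite /GRing.scale/= addrC; congr (_ + _); exact: mulrC.
Qed.

Lemma is_derive_compose f g t df dg : is_derive (g t) 1 f df -> is_derive t 1 g dg ->
  is_derive t 1 (fun s => f (g s)) (df * dg).
Proof. by move=> hf hg; exact: is_derive1_comp. Qed.

Lemma is_derive_const (a : R) t : is_derive t 1 (fun=> a) 0.
Proof. exact: is_derive_cst. Qed.

Lemma is_derive_scale (a : R) f t df : is_derive t 1 f df ->
  is_derive t 1 (fun s => a * f s) (a * df).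
Proof. by move=> hf; exact: is_deriveZ. Qed.

Lemma is_derive_bigsum (I : Type) (r : seq I) (P : pred I) (f : I -> R -> R)
    (df : I -> R) t : (forall i, P i -> is_derive t 1 (f i) (df i)) ->
  is_derive t 1 (fun s => \sum_(i <- r | P i) f i s) (\sum_(i <- r | P i) df i).
Proof.
move=> h; elim: r => [|i r IH].
  have -> : (fun s => \sum_(i <- [::] | P i) f i s) = (fun=> 0).
    by apply/funext => s; rewrite big_nil.
  by rewrite big_nil; exact: is_derive_const.
rewrite big_cons; case: ifP => Pi.
  have -> : (fun s => \sum_(i <- i :: r | P i) f i s) =
            (fun s => f i s + \sum_(i <- r | P i) f i s).
    by apply/funext => s; rewrite big_cons Pi.
  by apply: is_derive_add => //; exact: h.
suff -> : (fun s => \sum_(i <- i :: r | P i) f i s) =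
          (fun s => \sum_(i <- r | P i) f i s) by [].
by apply/funext => s; rewrite big_cons Pi.
Qed.

Lemma is_derive_shift f (a : R) t df : is_derive (t + a) 1 f df ->
  is_derive t 1 (fun s => f (s + a)) df.
Proof.
move=> hf; have hg : is_derive t (1:R) (fun s => s + a) 1.
  apply: (is_derive_eq (is_derive_add (is_derive_id _ _) (is_derive_const _ _))).
  by rewrite addr0.
by apply: (is_derive_eq (is_derive_compose (g := fun s => s + a) hf hg)); rewrite mulr1.
Qed.

Lemma is_derive_refl f (a : R) t df : is_derive (a - t) 1 f df ->
  is_derive t 1 (fun s => f (a - s)) (- df).
Proof.
move=> hf; have hg : is_derive t (1:R) (fun s => a - s) (-1).
  apply: (is_derive_eq (is_derive_sub (is_derive_const _ _) (is_derive_id _ _))).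
  by rewrite sub0r.
by apply: (is_derive_eq (is_derive_compose (g := fun s => a - s) hf hg)); rewrite mulrN1.
Qed.

Lemma nonincreasing_of_derive f df (a b : R) : a <= b ->
  (forall t, is_derive t 1 f (df t)) ->
  (forall t, a <= t <= b -> df t <= 0) -> f b <= f a.
Proof.
move=> ab hf hdf.
have cf : {within `[a, b], continuous f}.
  apply: continuous_subspaceT => t.
  apply/differentiable_continuous/derivable1_diffP; by case: (hf t).
have df0 t : t \in `]a, b[ -> (f^`())%classic t <= 0.
  rewrite in_itv/= => /andP[at_ tb].
  by have [_ dft] := hf t; rewrite derive1E dft hdf// (ltW at_) (ltW tb).
apply: (ler0_derive1_le_cc _ df0 cf) => //; rewrite ?in_itv/= ?lexx ?ab//.
Qed.

Lemma constant_of_derive f (a b : R) : a <= b ->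
  (forall t, is_derive t 1 f 0) -> f b = f a.
Proof.
move=> ab hf; apply/eqP; rewrite eq_le; apply/andP; split.
  by apply: (@nonincreasing_of_derive f (fun=> 0)).
rewrite -lerN2; apply: (@nonincreasing_of_derive (fun t => - f t) (fun=> 0)) => //.
move=> t; apply: (is_derive_eq (is_deriveN (hf t))).
by rewrite oppr0.
Qed.

Definition negpart (x : R) : R := Num.max 0 (- x).

Lemma negpart_ge0 x : 0 <= negpart x.
Proof. by rewrite /negpart le_max lexx. Qed.

Lemma negpart_ge x : - x <= negpart x.
Proof. by rewrite /negpart le_max lexx orbT. Qed.

Lemma negpart_eq0 x : negpart x = 0 -> 0 <= x.
Proof. by move=> h; have := negpart_ge x; rewrite h oppr_le0. Qed.

Lemma negpart_pos x : 0 <= x -> negpart x = 0.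
Proof. by move=> h; rewrite /negpart max_l// oppr_le0. Qed.

Lemma negpart_neg x : x < 0 -> negpart x = - x.
Proof. by move=> h; rewrite /negpart max_r// oppr_ge0 ltW. Qed.

(** Squaring removes the corner at 0: in all four sign cases the first-order remainder is at most
    [h ^+ 2]. *)
Lemma is_derive_negpart_sqr (x : R) :
  is_derive x 1 (fun y => negpart y ^+ 2) (- 2 * negpart x).
Proof.
have rem (h : R) : `|negpart (h + x) ^+ 2 - negpart x ^+ 2 - h * (- 2 * negpart x)|
                   <= h ^+ 2.
  have := negpart_ge0 x; have := negpart_ge0 (h + x).
  rewrite ler_norml.
  have [x0|x0] := ltP x 0; have [hx0|hx0] := ltP (h + x) 0;
    rewrite ?(negpart_neg x0) ?(negpart_neg hx0) ?(negpart_pos x0) ?(negpart_pos hx0);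
    by move=> _ _; apply/andP; split; nra.
have lim : h^-1 *: (negpart (h + x) ^+ 2 - negpart x ^+ 2) @[h --> 0^']
    --> - 2 * negpart x.
  apply/cvgrPdist_le => e e0; near=> h.
  have h0 : h != 0 by near: h; exact: nbhs_dnbhs_neq.
  rewrite distrC /GRing.scale/=.
  have -> : h^-1 * (negpart (h + x) ^+ 2 - negpart x ^+ 2) - - 2 * negpart x =
     h^-1 * (negpart (h + x) ^+ 2 - negpart x ^+ 2 - h * (- 2 * negpart x)).
    by field.
  rewrite normrM normfV ler_pdivrMl ?normr_gt0//.
  apply: le_trans (rem h) _.
  have -> : h ^+ 2 = `|h| * `|h| by rewrite -normrM -expr2 ger0_norm ?sqr_ge0.
  rewrite ler_wpM2l//.
  near: h; apply: nbhs_dnbhs; apply/nbhs_ballP; exists e => //= y.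
  by rewrite /ball/= sub0r normrN => /ltW.
have D : derivable (fun y => negpart y ^+ 2) x 1.
  rewrite /derivable [X in X @ _](_ : _ =
     fun h => h^-1 *: (negpart (h + x) ^+ 2 - negpart x ^+ 2)); last first.
    by apply/funext => h /=; rewrite [h%:A]mulr1.
  by apply/cvg_ex; eexists; exact: lim.
constructor => //; rewrite -derive1E; exact: cvg_lim lim.
Unshelve. all: by end_near.
Qed.

(* Gronwall for the sum of the squares of the negative parts. *)
Lemma maximum_principle (I : finType) (u du : I -> R -> R) (C T : R) :
  0 <= C -> (forall i, 0 <= u i 0) ->
  (forall i t, is_derive t 1 (u i) (du i t)) ->
  (forall i t, 0 <= t <= T -> u i t < 0 ->
     - C * \sum_j negpart (u j t) <= du i t) ->
  forall i t, 0 <= t <= T -> 0 <= u i t.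
Proof.
move=> C0 u0 hu hdu i0 T' /andP[T'0 T'T].
pose phi t := \sum_i negpart (u i t) ^+ 2.
pose dphi t := \sum_i (- 2 * negpart (u i t)) * du i t.
have hphi t : is_derive t 1 phi (dphi t).
  apply: is_derive_bigsum => i _.
  exact: (is_derive_compose (g := u i) (is_derive_negpart_sqr _) (hu i t)).
pose K : R := 2 * C * (#|I|%:R).
have phi0 t : 0 <= phi t by apply: sumr_ge0 => i _; exact: sqr_ge0.
have dphi_le t : 0 <= t <= T -> dphi t <= K * phi t.
  move=> tT.
  have step : dphi t <= 2 * C * (\sum_i negpart (u i t)) ^+ 2.
    rewrite expr2 mulr_suml mulr_sumr; apply: ler_sum => i _.
    have [ui|ui] := ltP (u i t) 0; last by rewrite negpart_pos// !(mulr0,mul0r).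
    have := hdu i t tT ui; have := negpart_ge0 (u i t).
    set S := \sum_j _; nra.
   apply: le_trans step _; rewrite /K -[leRHS]mulrA ler_wpM2l ?mulr_ge0//.
  (* Cauchy-Schwarz against the constant 1, from expanding the double sum of squared differences. *)
  have key (a : I -> R) : (\sum_i a i) ^+ 2 <= #|I|%:R * \sum_i a i ^+ 2.
    have : 0 <= \sum_i \sum_j (a i - a j) ^+ 2.
      by do 2!(apply: sumr_ge0 => ? _); exact: sqr_ge0.
    under eq_bigr => i _ do under eq_bigr => j _ do rewrite sqrrB.
    have -> : \sum_i \sum_j (a i ^+ 2 - a i * a j *+ 2 + a j ^+ 2) =
       2 * (#|I|%:R * \sum_i a i ^+ 2) - 2 * (\sum_i a i) ^+ 2.
      under eq_bigr => i _ do rewrite big_split sumrB/= sumr_const.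
      rewrite big_split sumrB/= sumr_const.
      rewrite -[X in _ + X]mulr_natl.
      under eq_bigr => i _ do rewrite -mulr_natl.
      rewrite -mulr_sumr.
      have -> : \sum_i \sum_j a i * a j *+ 2 = 2 * (\sum_i a i) ^+ 2.
        rewrite expr2 mulr_suml mulr_sumr; apply: eq_bigr => i _.
        by rewrite mulr_sumr mulr_sumr; apply: eq_bigr => j _; rewrite -mulr_natl.
      by ring.
    by lra.
  exact: key.
pose psi t := expR (- K * t) * phi t.
pose dpsi t := (- K * expR (- K * t)) * phi t + expR (- K * t) * dphi t.
have hpsi t : is_derive t 1 psi (dpsi t).
  apply: is_derive_mul => //.
  apply: (is_derive_eq (is_derive_compose (g := fun s => - K * s) (is_derive_expR _)
    (is_derive_scale (- K) (is_derive_id t 1)))).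
  by rewrite mulr1 mulrC.
have psi_le : psi T' <= psi 0.
  apply: (nonincreasing_of_derive T'0 hpsi) => t /andP[t0 tT'].
  have := dphi_le t; rewrite t0 (le_trans tT' T'T) => /(_ isT) h.
  have := expR_gt0 (- K * t); rewrite /dpsi => ex.
  have -> : - K * expR (- K * t) * phi t + expR (- K * t) * dphi t =
    expR (- K * t) * (dphi t - K * phi t) by ring.
  by rewrite pmulr_rle0// subr_le0.
have phi00 : phi 0 = 0.
  by rewrite /phi big1// => i _; rewrite negpart_pos// expr0n.
have : phi T' = 0.
  apply/eqP; rewrite eq_le phi0 andbT.
  move: psi_le; rewrite /psi phi00 mulr0 pmulr_rle0//; exact: expR_gt0.
move/eqP; rewrite psumr_eq0 => [/allP/(_ i0)|? _]; last exact: sqr_ge0.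
by rewrite mem_index_enum => /(_ isT)/=; rewrite sqrf_eq0 => /eqP/negpart_eq0.
Qed.

End Calculus.

Section ChainMaximum.
Variable R : realType.

(** Where [u k t] is negative the killing term helps, and each of the two neighbour terms is at
    least minus the sum of the negative parts; hence the constant 2. The zeros of [a] and [b] at the
    ends make out-of-range neighbours harmless. *)
Lemma chain_maximum_principle (n : nat) (a b c : nat -> R) (u du : nat -> R -> R) (T : R) :
  (forall k, 0 <= a k <= 1) -> (forall k, 0 <= b k <= 1) -> (forall k, 0 <= c k) ->
  a n.-1 = 0 -> b 0%N = 0 ->
  (forall k, (k < n)%N -> 0 <= u k 0) ->
  (forall k (t : R), (k < n)%N -> is_derive t 1 (u k) (du k t)) ->
  (forall k (t : R), (k < n)%N -> 0 <= t <= T -> u k t < 0 ->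
     a k * u k.+1 t + b k * u k.-1 t - c k * u k t <= du k t) ->
  forall k (t : R), (k < n)%N -> 0 <= t <= T -> 0 <= u k t.
Proof.
move=> ha hb hc an b0 u0 hu hdu k t kn tT.
apply: (@maximum_principle R 'I_n (fun i : 'I_n => u i) (fun i : 'I_n => du i) 2 T
  _ _ _ _ (Ordinal kn) t) => //.
- by move=> i; exact: u0.
- by move=> i s; exact: hu.
move=> i s sT ui; apply: le_trans (hdu i s (ltn_ord i) sT ui).
set S := \sum_j _.
have S0 : 0 <= S by apply: sumr_ge0 => j _; exact: negpart_ge0.
have uS j : (j < n)%N -> - S <= u j s.
  move=> jn; rewrite lerNl (le_trans (negpart_ge _))// /S (bigD1 (Ordinal jn))//= lerDl.
  by apply: sumr_ge0 => l _; exact: negpart_ge0.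
have [/andP[a0 a1] /andP[b0' b1]] := (ha i, hb i).
have A1 : - S <= a i * u i.+1 s.
  have [iN|iN] := ltnP i.+1 n; first by have := uS _ iN; nra.
  suff -> : a i = 0 by rewrite mul0r oppr_le0.
  by rewrite -an; congr a; have := ltn_ord i; lia.
have A2 : - S <= b i * u i.-1 s.
  have [i0|i0] := posnP i; first by rewrite i0 b0 mul0r oppr_le0.
  have /uS : (i.-1 < n)%N by have := ltn_ord i; lia.
  nra.
have := hc i; nra.
Qed.

End ChainMaximum.

(** * Kernels of birth-and-death chains given by their backward equation *)

Section Kernel.
Variable R : realType.
Implicit Types (p q pi f : nat -> R) (H : R -> nat -> nat -> R).

Definition generator p q f (k : nat) : R :=
  p k * (f k.+1 - f k) + q k * (f k.-1 - f k).

(** Indices are natural numbers, so neighbours need no casts; [p N = 0] and [q 0 = 0] cut off what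
    lies beyond the ends. Of [H] only the backward equation and the initial value are recorded:
    positivity, total mass, symmetry and the semigroup law follow from the maximum principle and
    self-adjointness. *)
Record bd_kernel (N : nat) p q pi H : Prop := BdKernel {
  bd_N : (0 < N)%N;
  bd_p0 : forall k, 0 <= p k;
  bd_q0 : forall k, 0 <= q k;
  bd_pq : forall k, p k + q k <= 1;
  bd_p : forall k, (k < N)%N -> 0 < p k;
  bd_pN : p N = 0;
  bd_q00 : q 0%N = 0;
  bd_pi : forall k, (k <= N)%N -> 0 < pi k;
  bd_sum : \sum_(0 <= k < N.+1) pi k = 1;
  bd_rev : forall k, (k < N)%N -> pi k * p k = pi k.+1 * q k.+1;
  bd_H0 : forall x y, (x <= N)%N -> (y <= N)%N -> H 0 x y = (x == y)%:R;
  bd_dH : forall x y (t : R), (x <= N)%N -> (y <= N)%N ->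
    is_derive t 1 (fun s => H s x y) (generator p q (fun z => H t z y) x)
}.

(** Reflection exchanges births and deaths, so every estimate for the chain started at [0] has a
    counterpart at [N]. *)
Lemma bd_kernel_reflect N p q pi H : bd_kernel N p q pi H ->
  bd_kernel N (fun k => q (N - k)%N) (fun k => p (N - k)%N) (fun k => pi (N - k)%N)
    (fun t x y => H t (N - x)%N (N - y)%N).
Proof.
case=> N0 p0 q0 pq pp pN q00 pi0 sm rv H0 dH; split => //.
- by move=> k; rewrite addrC.
- move=> k kN; have h1 : (N - k.+1 < N)%N by lia.
  have := rv _ h1; have -> : ((N - k.+1).+1 = N - k)%N by lia.
  have := pi0 (N - k)%N (leq_subr _ _); have := pi0 (N - k.+1)%N (leq_subr _ _).
  have := pp _ h1 => a b c e; have : 0 < pi (N - k)%N * q (N - k)%N by rewrite -e mulr_gt0.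
  by rewrite pmulr_rgt0.
- by rewrite subnn.
- by rewrite subn0.
- by move=> k kN; rewrite pi0// leq_subr.
- by rewrite -[RHS]sm [RHS]big_nat_rev/=; apply: eq_bigr => k _; rewrite add0n subSS.
- move=> k kN; have h1 : (N - k.+1 < N)%N by lia.
  by have := rv _ h1; have -> : ((N - k.+1).+1 = N - k)%N by lia.
- move=> x y xN yN; rewrite H0 ?leq_subr//; congr (_%:R); congr nat_of_bool.
  by apply/eqP/eqP; lia.
- move=> x y t xN yN; apply: (is_derive_eq (dH _ _ _ (leq_subr _ _) (leq_subr _ _))).
  rewrite /generator addrC; congr (_ + _).
    by rewrite subnS.
  have [->|x0] := posnP x; first by rewrite subn0 pN !mul0r.
  by congr (_ * (H t _ _ - _)); lia.
Qed.

End Kernel.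

(** * Heat equation of a birth-and-death chain *)

Section HeatEquation.
Variables (R : realType) (N : nat) (p q pi : nat -> R) (H : R -> nat -> nat -> R).
Hypothesis hK : bd_kernel N p q pi H.
Implicit Types (f g : nat -> R) (u v : R -> nat -> R) (t s T : R) (x y k : nat).

Let leN k : (k < N.+1)%N -> (k <= N)%N. Proof. by rewrite ltnS. Qed.

Lemma sum_delta f x : (x <= N)%N ->
  \sum_(0 <= z < N.+1) (z == x)%:R * f z = f x.
Proof.
move=> xN; rewrite (bigD1_seq x) ?mem_index_iota ?iota_uniq//= eqxx mul1r.
by rewrite big1 ?addr0// => i /negPf ->; rewrite mul0r.
Qed.

(** Summation by parts: reversibility turns the downward flow from [k.+1] into the upward flow from
    [k], and the two sums pair edge by edge. *)
Lemma dirichlet_form f g :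
  \sum_(0 <= z < N.+1) pi z * generator p q f z * g z =
  - \sum_(0 <= k < N) pi k * p k * (f k.+1 - f k) * (g k.+1 - g k).
Proof.
have split : \sum_(0 <= z < N.+1) pi z * generator p q f z * g z =
   \sum_(0 <= z < N.+1) pi z * p z * (f z.+1 - f z) * g z +
   \sum_(0 <= z < N.+1) pi z * q z * (f z.-1 - f z) * g z.
  by rewrite -big_split/=; apply: eq_bigr => z _; rewrite /generator; ring.
rewrite split big_nat_recr//= (bd_pN hK) mulr0 !mul0r addr0.
rewrite [X in _ + X]big_nat_recl//= (bd_q00 hK) mulr0 !mul0r add0r.
rewrite -sumrN -big_split/= !big_nat; apply: eq_bigr => k /andP[_ kN].
by rewrite -(bd_rev hK kN); ring.
Qed.

Lemma generator_selfadjoint f g :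
  \sum_(0 <= z < N.+1) pi z * generator p q f z * g z =
  \sum_(0 <= z < N.+1) pi z * f z * generator p q g z.
Proof.
rewrite dirichlet_form; under [RHS]eq_bigr => z _ do rewrite mulrAC.
by rewrite dirichlet_form; congr (- _); apply: eq_bigr => k _; ring.
Qed.

Definition heat_solution u := forall k t, (k <= N)%N ->
  is_derive t 1 (fun s => u s k) (generator p q (u t) k).

(** Analytic form of stopping at [x]: the supersolution inequality is asked only below [x], and the
    sign on [[x, N]] is given. With [x = N.+1] this is the plain maximum principle. *)
Lemma heat_barrier x u du T :
  (forall k t, (k <= N)%N -> is_derive t 1 (fun s => u s k) (du t k)) ->
  (forall k, (k <= N)%N -> 0 <= u 0 k) ->
  (forall k t, (x <= k <= N)%N -> 0 <= t <= T -> 0 <= u t k) ->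
  (forall k t, (k < x)%N -> (k <= N)%N -> 0 <= t <= T ->
     generator p q (u t) k <= du t k) ->
  forall k t, (k <= N)%N -> 0 <= t <= T -> 0 <= u t k.
Proof.
move=> hu u0 ux hdu k t kN.
apply: (@chain_maximum_principle R N.+1 p q (fun k => p k + q k)
  (fun k t => u t k) (fun k t => du t k) T) => //=.
- move=> j; rewrite (bd_p0 hK)/= (le_trans _ (bd_pq hK j))// lerDl.
  exact: (bd_q0 hK).
- move=> j; rewrite (bd_q0 hK)/= (le_trans _ (bd_pq hK j))// lerDr.
  exact: (bd_p0 hK).
- by move=> j; rewrite addr_ge0// ?(bd_p0 hK)// (bd_q0 hK).
- exact: (bd_pN hK).
- exact: (bd_q00 hK).
move=> j s jN sT us; have [jx|xj] := ltnP j x.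
  by apply: le_trans (hdu _ _ jx jN sT); rewrite /generator; lra.
by have := ux j s; rewrite xj -ltnS jN => /(_ isT sT); rewrite leNgt us.
Qed.

Lemma heat_nonneg u : heat_solution u -> (forall k, (k <= N)%N -> 0 <= u 0 k) ->
  forall k t, (k <= N)%N -> 0 <= t -> 0 <= u t k.
Proof.
move=> hu u0 k t kN t0.
apply: (@heat_barrier N.+1 u (fun t => generator p q (u t)) t) => //.
- by move=> j s /andP[xj jN]; lia.
by rewrite t0 lexx.
Qed.

Lemma heat_solutionB u v : heat_solution u -> heat_solution v ->
  heat_solution (fun t k => u t k - v t k).
Proof.
move=> hu hv k t kN; apply: (is_derive_eq (is_derive_sub (hu k t kN) (hv k t kN))).
by rewrite /generator; ring.
Qed.

Lemma heat_le u v : heat_solution u -> heat_solution v ->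
  (forall k, (k <= N)%N -> u 0 k <= v 0 k) ->
  forall k t, (k <= N)%N -> 0 <= t -> u t k <= v t k.
Proof.
move=> hu hv uv k t kN t0; rewrite -subr_ge0.
apply: (@heat_nonneg (fun t k => v t k - u t k)) => //.
  exact: heat_solutionB.
by move=> j jN; rewrite subr_ge0 uv.
Qed.

Lemma heat_unique u v : heat_solution u -> heat_solution v ->
  (forall k, (k <= N)%N -> u 0 k = v 0 k) ->
  forall k t, (k <= N)%N -> 0 <= t -> u t k = v t k.
Proof.
move=> hu hv uv k t kN t0; apply/eqP; rewrite eq_le.
by rewrite !heat_le// => j jN; rewrite uv.
Qed.

(* The successive differences of a solution solve a birth-and-death equation
   with killing, so their sign is preserved. *)
Lemma heat_nonincreasing u : heat_solution u ->
  (forall k, (k < N)%N -> u 0 k.+1 <= u 0 k) ->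
  forall k t, (k < N)%N -> 0 <= t -> u t k.+1 <= u t k.
Proof.
move=> hu u0 k t kN t0; rewrite -subr_ge0.
apply: (@chain_maximum_principle R N (fun k => p k.+1) q (fun k => p k + q k.+1)
  (fun k t => u t k - u t k.+1)
  (fun k t => generator p q (u t) k - generator p q (u t) k.+1) t) => //=.
- move=> j; rewrite (bd_p0 hK)/= (le_trans _ (bd_pq hK j.+1))// lerDl.
  exact: (bd_q0 hK).
- move=> j; rewrite (bd_q0 hK)/= (le_trans _ (bd_pq hK j))// lerDr.
  exact: (bd_p0 hK).
- by move=> j; rewrite addr_ge0// ?(bd_p0 hK)// (bd_q0 hK).
- by rewrite prednK ?(bd_pN hK)// (bd_N hK).
- exact: (bd_q00 hK).
- by move=> j jN; rewrite subr_ge0 u0.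
- by move=> j s jN; apply: is_derive_sub; apply: hu => //; exact: ltnW.
- move=> j s jN sT _; rewrite /generator/=; case: j jN => [|j] jN /=.
    by rewrite (bd_q00 hK) !mul0r le_eqVlt; apply/orP; left; apply/eqP; ring.
  by rewrite le_eqVlt; apply/orP; left; apply/eqP; ring.
by rewrite t0 lexx.
Qed.

Definition semigroup t f x : R := \sum_(0 <= y < N.+1) H t x y * f y.

Lemma heat_semigroup f : heat_solution (fun t => semigroup t f).
Proof.
move=> k t kN; rewrite /semigroup.
under [X in is_derive _ _ X _]funext => s do rewrite big_nat.
have h : is_derive t 1 (fun s => \sum_(0 <= y < N.+1 | (0 <= y < N.+1)%N) H s k y * f y)
    (\sum_(0 <= y < N.+1 | (0 <= y < N.+1)%N) generator p q (fun z => H t z y) k * f y).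
  apply: is_derive_bigsum => y /andP[_ yN].
  have h := is_derive_mul (bd_dH hK t kN (leN yN)) (is_derive_const (f y) t).
  by apply: (is_derive_eq h); rewrite mulr0 addr0.
apply: (is_derive_eq h); rewrite -big_nat /generator -!sumrB !mulr_sumr -big_split/=.
by apply: eq_bigr => i _; ring.
Qed.

Lemma semigroup0 f x : (x <= N)%N -> semigroup 0 f x = f x.
Proof.
move=> xN; rewrite /semigroup -[RHS](sum_delta f xN) !big_nat.
apply: eq_bigr => y /andP[_ yN]; rewrite (bd_H0 hK) 1?eq_sym//; exact: leN.
Qed.

Lemma heat_cst (a : R) : heat_solution (fun _ _ => a).
Proof.
move=> k t kN; apply: (is_derive_eq (is_derive_const _ _)).
by rewrite /generator subrr !mulr0 addr0.
Qed.

Lemma heat_col y : (y <= N)%N -> heat_solution (fun t x => H t x y).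
Proof. by move=> yN k t kN; exact: (bd_dH hK). Qed.

Lemma heat_shift u s : heat_solution u -> heat_solution (fun t => u (t + s)).
Proof.
move=> hu k t kN; exact: (@is_derive_shift R (fun t => u t k) s t _ (hu k _ kN)).
Qed.

Lemma kernel_ge0 t x y : (x <= N)%N -> (y <= N)%N -> 0 <= t -> 0 <= H t x y.
Proof.
move=> xN yN t0; apply: (@heat_nonneg (fun t x => H t x y)) => //.
  exact: heat_col.
by move=> k kN; rewrite (bd_H0 hK).
Qed.

Lemma kernel_sum1 t x : (x <= N)%N -> 0 <= t -> \sum_(0 <= y < N.+1) H t x y = 1.
Proof.
move=> xN t0.
have := @heat_unique _ _ (heat_semigroup (fun=> 1)) (heat_cst 1) _ x t xN t0.
rewrite /semigroup => <-; first by apply: eq_bigr => y _; rewrite mulr1.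
by move=> k kN; exact: semigroup0.
Qed.

(** The pairing [g s] of [H s] with [H (t - s)] is constant because the generator is self-adjoint;
    its values at [s = 0] and [s = t] are the two sides. *)
Lemma kernel_symmetric t x y : (x <= N)%N -> (y <= N)%N -> 0 <= t ->
  pi x * H t x y = pi y * H t y x.
Proof.
move=> xN yN t0.
pose g s := \sum_(0 <= z < N.+1) pi z * H s z x * H (t - s) z y.
have hg s : is_derive s 1 g 0.
  rewrite /g.
  under [X in is_derive _ _ X _]funext => s' do rewrite big_nat.
  have h : is_derive s 1
      (fun s => \sum_(0 <= z < N.+1 | (0 <= z < N.+1)%N) pi z * H s z x * H (t - s) z y)
      (\sum_(0 <= z < N.+1 | (0 <= z < N.+1)%N)
        (pi z * generator p q (fun z => H s z x) z * H (t - s) z y -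
         pi z * H s z x * generator p q (fun z => H (t - s) z y) z)).
    apply: is_derive_bigsum => z /andP[_ zN].
    have h1 := is_derive_scale (pi z) (bd_dH hK s (leN zN) xN).
    have h2 := @is_derive_refl R (fun s => H s z y) t s _ (bd_dH hK (t - s) (leN zN) yN).
    by apply: (is_derive_eq (is_derive_mul h1 h2)); rewrite mulrN.
  by apply: (is_derive_eq h); rewrite -big_nat sumrB generator_selfadjoint subrr.
have := constant_of_derive t0 hg; rewrite /g subrr subr0 => e.
have e1 : \sum_(0 <= z < N.+1) pi z * H 0 z x * H t z y = pi x * H t x y.
  rewrite -(sum_delta (fun z => pi z * H t z y) xN) !big_nat.
  by apply: eq_bigr => z /andP[_ zN]; rewrite (bd_H0 hK)//; ring.
have e2 : \sum_(0 <= z < N.+1) pi z * H t z x * H 0 z y = pi y * H t y x.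
  rewrite -(sum_delta (fun z => pi z * H t z x) yN) !big_nat.
  by apply: eq_bigr => z /andP[_ zN]; rewrite (bd_H0 hK)//; ring.
by rewrite -e1 -e e2.
Qed.

Lemma semigroupD t s f x : (x <= N)%N -> 0 <= t -> 0 <= s ->
  semigroup (t + s) f x = semigroup t (semigroup s f) x.
Proof.
move=> xN t0 s0.
apply: (@heat_unique _ _ (@heat_shift _ s (heat_semigroup f))
  (heat_semigroup (semigroup s f)) _ x t xN t0) => k kN.
by rewrite add0r semigroup0.
Qed.

Lemma kernel_chapman t s x y : (x <= N)%N -> (y <= N)%N -> 0 <= t -> 0 <= s ->
  H (t + s) x y = \sum_(0 <= z < N.+1) H t x z * H s z y.
Proof.
move=> xN yN t0 s0.
apply: (@heat_unique (fun t x => H (t + s) x y)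
  (fun t => semigroup t (fun z => H s z y))) => //.
- by apply: (@heat_shift (fun t x => H t x y)); exact: heat_col.
- exact: heat_semigroup.
- by move=> k kN; rewrite add0r semigroup0.
Qed.

Lemma kernel_stationary t y : (y <= N)%N -> 0 <= t ->
  \sum_(0 <= x < N.+1) pi x * H t x y = pi y.
Proof.
move=> yN t0; rewrite -[RHS]mulr1 -(kernel_sum1 yN t0) mulr_sumr !big_nat.
by apply: eq_bigr => x /andP[_ xN]; rewrite kernel_symmetric.
Qed.

Lemma semigroup_selfadjoint t f g : 0 <= t ->
  \sum_(0 <= x < N.+1) pi x * semigroup t f x * g x =
  \sum_(0 <= x < N.+1) pi x * f x * semigroup t g x.
Proof.
move=> t0; rewrite /semigroup.
under eq_bigr => x _ do rewrite mulr_sumr mulr_suml.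
under [RHS]eq_bigr => x _ do rewrite mulr_sumr.
rewrite exchange_big/= !big_nat; apply: eq_bigr => y /andP[_ yN].
rewrite !big_nat; apply: eq_bigr => x /andP[_ xN].
by rewrite mulrA (kernel_symmetric (leN xN) (leN yN) t0); ring.
Qed.

End HeatEquation.

(** * Total positivity *)

Section TotalPositivity.
Variables (R : realType) (N : nat) (p q pi : nat -> R) (H : R -> nat -> nat -> R).
Hypothesis hK : bd_kernel N p q pi H.
Implicit Types (f g : nat -> R) (t s : R) (x y k : nat).

(* For fixed columns y < y', the 2x2 minor D(a, b) of rows a < b solves the
   product-chain equation and vanishes on the diagonal a = b; this is the
   Karlin--McGregor argument. *)
Lemma kernel_tp2_lt x x' y y' t : (x < x')%N -> (x' <= N)%N -> (y < y')%N -> (y' <= N)%N ->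
  0 <= t -> H t x y' * H t x' y <= H t x y * H t x' y'.
Proof.
move=> xx' x'N yy' y'N t0; rewrite -subr_ge0.
pose D s a b := H s a y * H s b y' - H s a y' * H s b y.
have yN : (y <= N)%N by lia.
pose dD s a b := generator p q (fun z => H s z y) a * H s b y'
   + H s a y * generator p q (fun z => H s z y') b
   - (generator p q (fun z => H s z y') a * H s b y
      + H s a y' * generator p q (fun z => H s z y) b).
have hD s a b : (a <= N)%N -> (b <= N)%N -> is_derive s 1 (fun s => D s a b) (dD s a b).
  by move=> aN bN; apply: is_derive_sub; apply: is_derive_mul; exact: (bd_dH hK).
have dDE s a b : dD s a b = generator p q (fun z => D s z b) a + generator p q (D s a) b.
  by rewrite /dD /D /generator; ring.
have leN (i : 'I_N.+1) : (i <= N)%N by rewrite -ltnS.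
have xN : (x < N.+1)%N by lia.
have x'N1 : (x' < N.+1)%N by lia.
pose I : finType := ('I_N.+1 * 'I_N.+1)%type.
pose u (i : I) s := if (i.1 < i.2)%N then D s i.1 i.2 else 0.
pose du (i : I) s := if (i.1 < i.2)%N then dD s i.1 i.2 else 0.
suff : 0 <= u (Ordinal xN, Ordinal x'N1) t by rewrite /u /= xx'.
apply: (@maximum_principle R I u du 2 t) => //.
- move=> [a b]; rewrite /u/=; case: ifP => // ab.
  rewrite /D !(bd_H0 hK)// subr_ge0.
  have [ea|_] := eqVneq (a : nat) y'; last by rewrite mul0r mulr_ge0.
  have [eb|_] := eqVneq (b : nat) y; first by lia.
  by rewrite mulr0 mulr_ge0.
- move=> [a b] s; rewrite /u /du/=; case: ifP => ab; first exact: hD.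
  exact: is_derive_const.
- move=> [a b] s st; rewrite {1}/u {1}/du/=; case: ifP => ab; last by rewrite ltxx.
  move=> Dab.
  set S := \sum_j _.
  have S0 : 0 <= S by apply: sumr_ge0 => j _; exact: negpart_ge0.
  have DS c d : (c <= d)%N -> (d <= N)%N -> - S <= D s c d.
    rewrite leq_eqVlt => /orP[/eqP -> dN|cd dN].
      have -> : D s d d = 0 by rewrite /D mulrC subrr.
      by rewrite oppr_le0.
    have c' : (c < N.+1)%N by lia.
    have d' : (d < N.+1)%N by lia.
    rewrite lerNl /S (bigD1 (Ordinal c', Ordinal d'))//= {1}/u/= cd.
    apply: le_trans (negpart_ge _) _; rewrite lerDl.
    by apply: sumr_ge0 => j _; exact: negpart_ge0.
  rewrite dDE /generator.
  have pa0 := bd_p0 hK a; have qa0 := bd_q0 hK a; have pqa := bd_pq hK a.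
  have pb0 := bd_p0 hK b; have qb0 := bd_q0 hK b; have pqb := bd_pq hK b.
  have bN := leN b.
  (* Only one of the two rows moves at a time, so from [a < b] every neighbour still satisfies
     [a <= b]. *)
  have h1 : - S <= D s a.+1 b by apply: DS.
  have h2 : - S <= D s a.-1 b by apply: DS; rewrite ?(leq_trans (leq_pred _))// ltnW.
  have h4 : - S <= D s a b.-1.
    by apply: DS; [rewrite -ltnS (ltn_predK ab)|rewrite (leq_trans (leq_pred _))].
  have h3 : p b * - S <= p b * (D s a b.+1).
    have [bN'|bN'] := ltnP b N; first by apply: ler_wpM2l => //; apply: DS; rewrite // leqW// ltnW.
    have -> : (b : nat) = N by apply/eqP; rewrite eqn_leq bN.
    by rewrite (bd_pN hK) !mul0r.
  have k1 := ler_wpM2l pa0 h1; have k2 := ler_wpM2l qa0 h2; have k4 := ler_wpM2l qb0 h4.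
  have k5 : 0 <= (p a + q a) * - D s a b.
    by rewrite mulr_ge0 ?addr_ge0// oppr_ge0 ltW.
  have k6 : 0 <= (p b + q b) * - D s a b.
    by rewrite mulr_ge0 ?addr_ge0// oppr_ge0 ltW.
  have k7 : 0 <= (1 - (p a + q a)) * S by rewrite mulr_ge0// subr_ge0.
  have k8 : 0 <= (1 - (p b + q b)) * S by rewrite mulr_ge0// subr_ge0.
  by lra.
- by rewrite t0 lexx.
Qed.

Lemma kernel_tp2 x x' y y' t : (x <= x')%N -> (x' <= N)%N -> (y <= y')%N -> (y' <= N)%N ->
  0 <= t -> H t x y' * H t x' y <= H t x y * H t x' y'.
Proof.
rewrite leq_eqVlt => /orP[/eqP -> _ _ _ _|xx' x'N]; first by rewrite mulrC.
rewrite leq_eqVlt => /orP[/eqP -> _ _|yy' y'N t0]; first by [].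
exact: kernel_tp2_lt.
Qed.

Definition cdf (f : nat -> R) k := \sum_(0 <= y < k.+1) f y.

Lemma cdf_semigroup t x k : (k <= N)%N ->
  cdf (H t x) k = semigroup N H t (fun y => (y <= k)%:R) x.
Proof.
move=> kN; rewrite /cdf /semigroup [RHS](big_cat_nat _ (n := k.+1))//=.
rewrite [X in _ + X]big_nat_cond [X in _ + X]big1 ?addr0.
  rewrite [LHS]big_nat [RHS]big_nat; apply: eq_bigr => y /andP[_].
  by rewrite ltnS => ->; rewrite mulr1.
by move=> y; rewrite andbT => /andP[ky _]; rewrite leqNgt ky mulr0.
Qed.

(** Stochastic monotonicity: the indicator of [[0, k]] is nonincreasing, and the heat flow keeps it
    so. *)
Lemma cdf_kernel_nonincreasing t x x' k : (x <= x')%N -> (x' <= N)%N -> (k <= N)%N ->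
  0 <= t -> cdf (H t x') k <= cdf (H t x) k.
Proof.
move=> xx' x'N kN t0; rewrite !cdf_semigroup//.
elim: x' xx' x'N => [|x' IH] xx' x'N; first by have -> : x = 0%N by lia.
move: xx'; rewrite leq_eqVlt => /orP[/eqP -> //|xx'].
apply: le_trans (IH _ _); [|lia|lia].
apply: (heat_nonincreasing hK (heat_semigroup hK _) _ x'N t0) => j jN.
rewrite !(semigroup0 hK) ?ler_nat//; last exact: ltnW.
by case: (leqP j k) => jk; case: (leqP j.+1 k) => //; lia.
Qed.

Lemma density_sym t x y : (x <= N)%N -> (y <= N)%N -> 0 <= t ->
  H t x y / pi y = H t y x / pi x.
Proof.
move=> xN yN t0; have := kernel_symmetric hK xN yN t0.
have := bd_pi hK xN; have := bd_pi hK yN => y0 x0 e.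
by apply/eqP; rewrite eqr_div ?lt0r_neq0// mulrC e mulrC.
Qed.

(** By symmetry the density in [y] is, up to the factor [1 / pi 0], the heat solution started from
    the indicator of [0], which is nonincreasing. *)
Lemma density_start_nonincreasing t y y' : (y <= y')%N -> (y' <= N)%N -> 0 <= t ->
  H t 0%N y' / pi y' <= H t 0%N y / pi y.
Proof.
move=> yy' y'N t0; have yN := leq_trans yy' y'N.
rewrite (density_sym (leq0n N) y'N t0) (density_sym (leq0n N) yN t0).
rewrite ler_pM2r ?invr_gt0 ?(bd_pi hK)//.
elim: y' yy' y'N => [|z IH] yz zN; first by have -> : y = 0%N by lia.
move: yz; rewrite leq_eqVlt => /orP[/eqP -> //|yz].
apply: le_trans (IH _ _); [|lia|lia].
apply: (@heat_nonincreasing _ _ _ _ _ _ hK (fun t x => H t x 0%N)) => //.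
  exact: (heat_col hK).
by move=> j jN; rewrite !(bd_H0 hK) ?(ltnW jN)// ler0n.
Qed.

Lemma sum_split k f : (k <= N)%N ->
  \sum_(0 <= y < N.+1) f y = cdf f k + \sum_(k.+1 <= y < N.+1) f y.
Proof. by move=> kN; rewrite /cdf -big_cat_nat. Qed.

(** The hypothesis makes [f - g] nonnegative on an initial segment and nonpositive after it, so the
    cdf difference at the crossing point realises the total variation. The point is the last [y]
    with [g y < f y]; if there is none, [f = g] on [[0, N]] and [N] serves. *)
Lemma single_crossing f g :
  \sum_(0 <= y < N.+1) f y = \sum_(0 <= y < N.+1) g y ->
  (forall y y', (y < y')%N -> (y' <= N)%N -> g y' < f y' -> g y <= f y) ->
  exists2 k, (k <= N)%N &
    2^-1 * \sum_(0 <= y < N.+1) `|f y - g y| = cdf f k - cdf g k.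
Proof.
move=> fg cross.
have [[y0 /andP[y0N y0fg]]|no] := pselect (exists y, (y <= N)%N && (g y < f y)).
  have ex : exists y, (y <= N)%N && (g y < f y) by exists y0; rewrite y0N.
  have bnd y : (y <= N)%N && (g y < f y) -> (y <= N)%N by case/andP.
  have [k /andP[kN kfg] kmax] := ex_maxnP ex bnd.
  exists k => //; move: fg; rewrite !(sum_split _ kN) => fg.
  have -> : cdf (fun y => `|f y - g y|) k = cdf f k - cdf g k.
    rewrite /cdf -sumrB !big_nat; apply: eq_bigr => y /andP[_ yk].
    rewrite ger0_norm// subr_ge0; move: yk; rewrite ltnS leq_eqVlt.
    by case/orP => [/eqP ->|yk]; [exact: ltW|exact: (cross y k)].
  have -> : \sum_(k.+1 <= y < N.+1) `|f y - g y| =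
     \sum_(k.+1 <= y < N.+1) g y - \sum_(k.+1 <= y < N.+1) f y.
    rewrite -sumrB !big_nat; apply: eq_bigr => y /andP[ky yN].
    rewrite ler0_norm ?opprB// subr_le0 leNgt; apply/negP => h.
    by have := kmax y; rewrite h -ltnS yN => /(_ isT); lia.
  by lra.
have le y : (y < N.+1)%N -> f y <= g y.
  by move=> yN; rewrite leNgt; apply/negP => h; apply: no; exists y; rewrite -ltnS yN.
exists N => //; rewrite /cdf fg subrr.
have -> : \sum_(0 <= y < N.+1) `|f y - g y| = \sum_(0 <= y < N.+1) (g y - f y).
  rewrite !big_nat; apply: eq_bigr => y /andP[_ yN].
  by rewrite distrC ger0_norm// subr_ge0 le.
by rewrite sumrB fg subrr mulr0.
Qed.

Lemma tv_start_crossing t : 0 <= t -> exists2 k, (k <= N)%N &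
  2^-1 * \sum_(0 <= y < N.+1) `|H t 0%N y - pi y| = cdf (H t 0%N) k - cdf pi k.
Proof.
move=> t0; apply: single_crossing; first by rewrite (kernel_sum1 hK)// (bd_sum hK).
move=> y y' yy' y'N h; have yN : (y <= N)%N by lia.
have := density_start_nonincreasing (ltnW yy') y'N t0.
have py := bd_pi hK yN; have py' := bd_pi hK y'N.
rewrite ler_pdivlMr// mulrAC => h2.
have : pi y <= H t 0%N y' / pi y' * pi y by rewrite ler_peMl ?ler_pdivlMr ?mul1r// ltW.
by rewrite mulrAC => /le_trans -> //.
Qed.

(** Triangle inequality through the start [0]. By total positivity [H t 0] crosses [H t x] once, and
    [cdf (H t x)] is at least [cdf (H t N)]; this leg costs [e0 + eN], the leg from [H t 0] to [pi]
    another [e0]. *)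
Lemma tv_start_le t x e0 eN : (x <= N)%N -> 0 <= t ->
  (forall k, (k <= N)%N -> cdf (H t 0%N) k - cdf pi k <= e0) ->
  (forall k, (k <= N)%N -> cdf pi k - cdf (H t N) k <= eN) ->
  2^-1 * \sum_(0 <= y < N.+1) `|H t x y - pi y| <= 2 * e0 + eN.
Proof.
move=> xN t0 h0 hN.
have [k kN ek] := tv_start_crossing t0.
have [j jN ej] : exists2 k, (k <= N)%N &
    2^-1 * \sum_(0 <= y < N.+1) `|H t 0%N y - H t x y| = cdf (H t 0%N) k - cdf (H t x) k.
  apply: single_crossing; first by rewrite !(kernel_sum1 hK).
  move=> y y' yy' y'N h; rewrite leNgt; apply/negP => h2.
  have yN : (y <= N)%N by lia.
  have := kernel_tp2 (leq0n x) xN (ltnW yy') y'N t0.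
  have := kernel_ge0 hK (leq0n N) yN t0; have := kernel_ge0 hK xN y'N t0; nra.
have tri : \sum_(0 <= y < N.+1) `|H t x y - pi y| <=
   \sum_(0 <= y < N.+1) `|H t 0%N y - H t x y| + \sum_(0 <= y < N.+1) `|H t 0%N y - pi y|.
  rewrite -big_split/=; apply: ler_sum => y _.
  by rewrite [X in _ <= X + _]distrC -[X in `|X|](subrKA (H t 0%N y)) ler_normD.
have := h0 k kN; have := h0 j jN; have := hN j jN.
by have := cdf_kernel_nonincreasing xN (leqnn N) jN t0; lra.
Qed.

(** The pair of opposite ends is almost the worst for separation. Write the corner density [c] as
    the sum of [c * H t x z] over [z]. For [z <= y] bound [c] by the density of [H t 0] at [y], for
    [z > y] by that of [H t N]; total positivity then trades the rows, and the sum is at most the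
    density at [(x, y)] times [1 + e]. *)
Lemma density_ge t x y e : (x <= N)%N -> (y <= N)%N -> 0 <= t ->
  cdf (H t 0%N) y - cdf (H t N) y <= e ->
  H t 0%N N / pi N <= (H t x y / pi y) * (1 + e).
Proof.
move=> xN yN t0 he.
have py := bd_pi hK yN; have pN := bd_pi hK (leqnn N).
set c := H t 0%N N / pi N; set a := H t x y / pi y.
have a0 : 0 <= a by apply: divr_ge0; [exact: (kernel_ge0 hK)|exact: ltW].
have c0 : c <= H t 0%N y / pi y by exact: density_start_nonincreasing.
have cN : c <= H t N y / pi y.
  rewrite density_sym// ler_pM2r ?invr_gt0//.
  elim: (y) yN => // z IH zN.
  apply: le_trans (IH (ltnW zN)) _.
  suff : 0 - H t z.+1 N <= 0 - H t z N by rewrite !sub0r lerN2.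
  apply: (@heat_nonincreasing _ _ _ _ _ _ hK (fun t x => 0 - H t x N)) => //.
  - by apply: heat_solutionB; [exact: heat_cst|exact: (heat_col hK)].
  - move=> j jN; rewrite !sub0r lerN2 !(bd_H0 hK) ?ler_nat// ?(ltnW jN)//.
    by case: eqVneq jN => // ->; rewrite ltnn.
have tot : c = \sum_(0 <= z < N.+1) c * H t x z.
  by rewrite -mulr_sumr (kernel_sum1 hK)// mulr1.
rewrite tot (sum_split _ yN).
have le1 : cdf (fun z => c * H t x z) y <= a * cdf (H t 0%N) y.
  rewrite /cdf mulr_sumr !big_nat; apply: ler_sum => z /andP[_ zy].
  have zN : (z <= N)%N by lia.
  apply: le_trans (_ : (H t 0%N y / pi y) * H t x z <= _).
    by rewrite ler_wpM2r ?(kernel_ge0 hK).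
  rewrite /a mulrAC [leRHS]mulrAC ler_pM2r ?invr_gt0// [leRHS]mulrC.
  by apply: kernel_tp2.
have le2 : \sum_(y.+1 <= z < N.+1) c * H t x z <= a * \sum_(y.+1 <= z < N.+1) H t N z.
  rewrite mulr_sumr !big_nat; apply: ler_sum => z /andP[yz zN].
  have zN' : (z <= N)%N by lia.
  apply: le_trans (_ : (H t N y / pi y) * H t x z <= _).
    by rewrite ler_wpM2r ?(kernel_ge0 hK).
  rewrite /a mulrAC [leRHS]mulrAC ler_pM2r ?invr_gt0// mulrC.
  by apply: kernel_tp2 => //; lia.
have := kernel_sum1 hK (leqnn N) t0; rewrite (sum_split _ yN) => e1.
have : a * (cdf (H t 0%N) y + \sum_(y.+1 <= z < N.+1) H t N z) <= a * (1 + e).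
  by rewrite ler_wpM2l//; lra.
by lra.
Qed.

(** At the intermediate time replace both kernels by their minima [m], [n] with [pi]. Since
    [(pi - m) * (pi - n) >= 0], one has [m * n / pi >= m + n - pi], and the masses of [m] and [n]
    are one minus the total variation distances. *)
Lemma density_ends_ge s t d0 dN : 0 <= s -> 0 <= t ->
  2^-1 * \sum_(0 <= y < N.+1) `|H s 0%N y - pi y| <= d0 ->
  2^-1 * \sum_(0 <= y < N.+1) `|H t N y - pi y| <= dN ->
  1 - d0 - dN <= H (s + t) 0%N N / pi N.
Proof.
move=> s0 t0 h0 hN.
rewrite (kernel_chapman hK)// mulr_suml.
have overlap (f : nat -> R) d : \sum_(0 <= y < N.+1) f y = 1 ->
   2^-1 * \sum_(0 <= y < N.+1) `|f y - pi y| <= d ->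
   1 - d <= \sum_(0 <= y < N.+1) Num.min (f y) (pi y).
  move=> f1 hd.
  have -> : \sum_(0 <= y < N.+1) Num.min (f y) (pi y) =
     \sum_(0 <= y < N.+1) 2^-1 * (f y + pi y - `|f y - pi y|).
    by apply: eq_bigr => y _; rewrite minr_absE mulrC.
  rewrite -mulr_sumr sumrB big_split/= f1 (bd_sum hK); lra.
have := overlap _ _ (kernel_sum1 hK (leq0n N) s0) h0.
have := overlap _ _ (kernel_sum1 hK (leqnn N) t0) hN.
suff : \sum_(0 <= y < N.+1) Num.min (H s 0%N y) (pi y) +
   \sum_(0 <= y < N.+1) Num.min (H t N y) (pi y) - \sum_(0 <= y < N.+1) pi y <=
   \sum_(0 <= y < N.+1) H s 0%N y * H t y N / pi N by rewrite (bd_sum hK); lra.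
rewrite -big_split -sumrB/= !big_nat; apply: ler_sum => y /andP[_ yN].
have py := bd_pi hK (yN : (y <= N)%N).
rewrite -mulrA density_sym//.
set a := H s 0%N y; set b := H t N y.
have a0 : 0 <= a by apply: (kernel_ge0 hK).
have b0 : 0 <= b by apply: (kernel_ge0 hK).
rewrite mulrA ler_pdivlMr//.
have := ge_min (pi y) a (pi y); have := ge_min a a (pi y).
have := ge_min (pi y) b (pi y); have := ge_min b b (pi y).
rewrite !lexx ?orbT/=.
have : 0 <= Num.min a (pi y) by rewrite le_min a0 ltW.
have : 0 <= Num.min b (pi y) by rewrite le_min b0 ltW.
move: (Num.min a _) (Num.min b _) => m n m0 n0 n1 n2 m1 m2.
have : m * n <= a * b by apply: ler_pM.
by nra.
Qed.

End TotalPositivity.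

(** * Hitting times *)

Section HittingTimes.
Variables (R : realType) (N : nat) (p q pi : nat -> R) (H : R -> nat -> nat -> R).
Hypothesis hK : bd_kernel N p q pi H.
Implicit Types (f g : nat -> R) (t s a : R) (x y k : nat).

Definition resistance k : R := (pi k * p k)^-1.

(** Electrical potential grounded from [x] on; the generator maps it to minus the divergence of
    [flux] relative to [pi]. *)
Definition potential (flux : nat -> R) x k : R :=
  \sum_(k <= j < x) resistance j * flux j.

(* The mean and the variance of the hitting time of x from k; the flux of the
   variance accounts for the squared gradient of the mean. *)
Definition hit_mean x k : R := potential (cdf pi) x k.

Definition hit_var x k : R := potential (fun j =>
  2 * \sum_(0 <= i < j) resistance i * cdf pi i ^+ 2 + resistance j * cdf pi j ^+ 2) x k.

Lemma resistance_gt0 k : (k < N)%N -> 0 < resistance k.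
Proof.
by move=> kN; rewrite invr_gt0 mulr_gt0// ?(bd_p hK)// (bd_pi hK)// ltnW.
Qed.

Lemma cdf_pi_gt0 k : (k <= N)%N -> 0 < cdf pi k.
Proof.
move=> kN; rewrite /cdf big_nat_recr//= ltr_wpDl ?(bd_pi hK)//.
by rewrite big_nat sumr_ge0// => j /andP[_ jk]; apply/ltW/(bd_pi hK); lia.
Qed.

Lemma cdf_pi_le k l : (k <= l)%N -> (l <= N)%N -> cdf pi k <= cdf pi l.
Proof.
move=> kl lN; rewrite /cdf (big_cat_nat _ (n := k.+1) (p := l.+1))//= lerDl.
by rewrite big_nat sumr_ge0// => j /andP[_ jk]; apply/ltW/(bd_pi hK); lia.
Qed.

Lemma cdf_pi_le1 k : (k <= N)%N -> cdf pi k <= 1.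
Proof. by move=> kN; rewrite -(bd_sum hK); exact: cdf_pi_le. Qed.

Lemma potentialS flux x k : (k < x)%N ->
  potential flux x k = resistance k * flux k + potential flux x k.+1.
Proof. by move=> kx; rewrite /potential big_ltn. Qed.

Lemma potential_ge flux x k : (x <= k)%N -> potential flux x k = 0.
Proof. by move=> xk; rewrite /potential big_geq. Qed.

Lemma potential_ge0 flux x k : (x <= N)%N ->
  (forall j, (j < N)%N -> 0 <= flux j) -> 0 <= potential flux x k.
Proof.
move=> xN h; rewrite /potential big_nat sumr_ge0// => j /andP[_ jx].
by rewrite mulr_ge0 ?h//; [apply/ltW/resistance_gt0|]; lia.
Qed.

Lemma up_potential flux x k : (k < x)%N -> (x <= N)%N ->
  p k * (potential flux x k.+1 - potential flux x k) = - flux k / pi k.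
Proof.
move=> kx xN; rewrite (potentialS _ kx) opprD addrCA subrr addr0 /resistance.
have kN : (k < N)%N by lia.
have /gt_eqF pk := bd_pi hK (ltnW kN); have /gt_eqF ppk := bd_p hK kN.
by field; rewrite pk ppk.
Qed.

Lemma down_potential flux x k : (k.+1 < x)%N -> (x <= N)%N ->
  q k.+1 * (potential flux x k - potential flux x k.+1) = flux k / pi k.+1.
Proof.
move=> kx xN; rewrite potentialS ?(ltnW kx)// addrK /resistance.
have kN : (k < N)%N by lia.
have /gt_eqF pk := bd_pi hK kN; rewrite (bd_rev hK kN).
have qk : 0 < q k.+1.
  have : 0 < pi k.+1 * q k.+1.
    by rewrite -(bd_rev hK kN) mulr_gt0 ?(bd_p hK)// (bd_pi hK)// ltnW.
  by rewrite pmulr_rgt0// (bd_pi hK).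
by field; rewrite pk gt_eqF.
Qed.

Lemma generator_potential flux x k : (k < x)%N -> (x <= N)%N ->
  generator p q (potential flux x) k =
  - (flux k - (if k is j.+1 then flux j else 0)) / pi k.
Proof.
move=> kx xN; rewrite /generator up_potential//.
case: k kx => [|k] kx /=; first by rewrite (bd_q00 hK) mul0r addr0 subr0.
by rewrite down_potential// opprB addrC mulrBl mulNr.
Qed.

(** The generator sends the mean to [-1], and the variance to minus the squared-gradient term
    produced by the square of the mean; these gradient terms cancel. *)
Lemma generator_hit_moment x k a : (k < x)%N -> (x <= N)%N ->
  generator p q (fun y => hit_var x y + (hit_mean x y + a) ^+ 2) k =
  - (2 * (hit_mean x k + a)).
Proof.
move=> kx xN.
have -> : generator p q (fun y => hit_var x y + (hit_mean x y + a) ^+ 2) k =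
   generator p q (hit_var x) k + 2 * (hit_mean x k + a) * generator p q (hit_mean x) k +
   (p k * (hit_mean x k.+1 - hit_mean x k) * (hit_mean x k.+1 - hit_mean x k) +
    q k * (hit_mean x k.-1 - hit_mean x k) * (hit_mean x k.-1 - hit_mean x k)).
  by rewrite /generator; ring.
rewrite !generator_potential// up_potential//.
have -> : hit_mean x k.+1 - hit_mean x k = - (resistance k * cdf pi k).
  by rewrite /hit_mean (potentialS _ kx); ring.
have /gt_eqF pk : 0 < pi k by apply: (bd_pi hK); lia.
case: k kx pk => [|k] kx pk /=.
  by rewrite (bd_q00 hK) /cdf !big_nat1 !big_geq//; field; rewrite pk.
rewrite down_potential//.
have -> : hit_mean x k - hit_mean x k.+1 = resistance k * cdf pi k.
  by rewrite /hit_mean potentialS 1?ltnW//; ring.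
rewrite big_nat_recr//= [cdf pi k.+1]/cdf big_nat_recr//= -/(cdf pi k).
by field; rewrite pk.
Qed.

Lemma hit_mean_ge0 x k : (x <= N)%N -> 0 <= hit_mean x k.
Proof. by move=> xN; apply: potential_ge0 => // j jN; apply/ltW/cdf_pi_gt0/ltnW. Qed.

Lemma hit_var_ge0 x k : (x <= N)%N -> 0 <= hit_var x k.
Proof.
move=> xN; apply: potential_ge0 => // j jN.
have r0 i : (i <= j)%N -> 0 <= resistance i * cdf pi i ^+ 2.
  by move=> ij; rewrite mulr_ge0 ?sqr_ge0//; apply/ltW/resistance_gt0/(leq_ltn_trans ij).
rewrite addr_ge0 ?r0// mulr_ge0// big_nat sumr_ge0// => i /andP[_ ij].
by rewrite r0// ltnW.
Qed.

(* Second-moment method: (elapsed time + remaining mean - a)^2 + remaining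
   variance is a martingale until x is hit. *)
Lemma hitting_barrier x t a b c f : (x <= N)%N -> 0 <= t ->
  (forall k, (k < x)%N -> c * f k <= b + (hit_var x k + (hit_mean x k + (t - a)) ^+ 2)) ->
  (forall k s, (x <= k <= N)%N -> 0 <= s <= t ->
     c * semigroup N H s f k <= b + (t - s - a) ^+ 2) ->
  c * semigroup N H t f 0%N <= b + (hit_var x 0 + (hit_mean x 0 - a) ^+ 2).
Proof.
move=> xN t0 init bdry.
pose u s k := b + (hit_var x k + (hit_mean x k + (t - s - a)) ^+ 2) -
   c * semigroup N H s f k.
pose du s k := - (2 * (hit_mean x k + (t - s - a))) -
   c * generator p q (semigroup N H s f) k.
have hu k s : (k <= N)%N -> is_derive s 1 (fun s => u s k) (du s k).
  move=> kN.
  have h1 : is_derive s (1:R) (fun s => hit_mean x k + (t - s - a)) (-1).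
    have h2 := is_derive_sub (is_derive_const t s) (is_derive_id s 1).
    have h3 := is_derive_sub h2 (is_derive_const a s).
    apply: (is_derive_eq (is_derive_add (is_derive_const (hit_mean x k) s) h3)).
    by rewrite !add0r subr0.
  have h4 := is_derive_sub (is_derive_add (is_derive_const b s)
    (is_derive_add (is_derive_const (hit_var x k) s) (is_derive_mul h1 h1)))
    (is_derive_scale c (heat_semigroup hK f s kN)).
  by apply: (is_derive_eq h4); rewrite /du; ring.
have at_bdry k : (x <= k)%N -> hit_var x k = 0 /\ hit_mean x k = 0.
  by move=> xk; rewrite /hit_var /hit_mean !potential_ge.
have ubdry k s : (x <= k <= N)%N -> 0 <= s <= t -> 0 <= u s k.
  move=> xkN st; have [e1 e2] := at_bdry k (andP xkN).1.
  by rewrite /u e1 e2 !add0r subr_ge0 bdry.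
have := @heat_barrier _ _ _ _ _ _ hK x u du t hu _ ubdry _ 0%N t (leq0n N).
rewrite t0 lexx /u subr_ge0 subrr sub0r => -> //.
  move=> k kN; have [kx|xk] := ltnP k x; last by apply: ubdry; rewrite ?xk ?lexx.
  by rewrite /u (semigroup0 hK)// subr_ge0 subr0 init.
move=> k s kx kN _; rewrite /du -(generator_hit_moment _ kx xN) /u le_eqVlt.
by apply/orP; left; apply/eqP; rewrite /generator; ring.
Qed.

Lemma semigroup_indicator_le1 s (P : pred nat) k : (k <= N)%N -> 0 <= s ->
  semigroup N H s (fun y => (P y)%:R) k <= 1.
Proof.
move=> kN s0; rewrite -[leRHS](kernel_sum1 hK kN s0) /semigroup !big_nat.
apply: ler_sum => y /andP[_ yN]; have := kernel_ge0 hK kN (yN : (y <= N)%N) s0.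
by case: (P y); rewrite ?mulr1 ?mulr0.
Qed.

(** Chebyshev's inequality: from [0], being in [[x, N]] at time [t] means having hit [x] by a time
    shorter than the mean. *)
Lemma lower_tail x t : (x <= N)%N -> 0 <= t -> t < hit_mean x 0 ->
  \sum_(x <= y < N.+1) H t 0%N y <= hit_var x 0 / (hit_mean x 0 - t) ^+ 2.
Proof.
move=> xN t0 ta; set a := hit_mean x 0.
have c0 : 0 < (a - t) ^+ 2 by rewrite exprn_gt0// subr_gt0.
have -> : \sum_(x <= y < N.+1) H t 0%N y = semigroup N H t (fun y => (x <= y)%:R) 0%N.
  rewrite /semigroup [RHS](big_cat_nat _ (n := x))//=; last by lia.
  rewrite [X in _ = X + _]big_nat_cond [X in _ = X + _]big1 ?add0r.
    by rewrite !big_nat; apply: eq_bigr => y /andP[-> _]; rewrite mulr1.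
  by move=> y; rewrite andbT => /andP[_ yx]; rewrite leqNgt yx mulr0.
rewrite ler_pdivlMr// mulrC.
have := @hitting_barrier x t a 0 ((a - t) ^+ 2) (fun y => (x <= y)%:R) xN t0.
rewrite subrr expr0n !addr0 add0r; apply.
  move=> k kx; rewrite leqNgt kx mulr0 add0r.
  by rewrite addr_ge0 ?hit_var_ge0 ?sqr_ge0.
move=> k s /andP[xk kN] /andP[s0 st]; rewrite add0r.
apply: le_trans (_ : (a - t) ^+ 2 * 1 <= _).
  by rewrite ler_pM2l//; exact: semigroup_indicator_le1.
by rewrite mulr1; have : t < a by []; nra.
Qed.

(** By stationarity [cdf pi k] averages [cdf (H s z) k] over [z]. Keep only [z <= x], where
    monotonicity in the start makes each term at least the one at [x]. *)
Lemma return_le s x y k : (k <= x)%N -> (x <= y)%N -> (y <= N)%N -> 0 <= s ->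
  cdf (H s y) k <= cdf pi k / cdf pi x.
Proof.
move=> kx xy yN s0.
have xN : (x <= N)%N by lia.
have kN : (k <= N)%N by lia.
apply: le_trans (cdf_kernel_nonincreasing hK xy yN kN s0) _.
rewrite ler_pdivlMr ?cdf_pi_gt0// [cdf pi x]/cdf mulr_sumr.
have -> : cdf pi k = \sum_(0 <= z < N.+1) pi z * cdf (H s z) k.
  under eq_bigr => z _ do rewrite /cdf mulr_sumr.
  rewrite exchange_big/= /cdf !big_nat; apply: eq_bigr => z /andP[_ zk].
  by rewrite (kernel_stationary hK)//; lia.
rewrite [leRHS](big_cat_nat _ (n := x.+1))//= -[leLHS]addr0 lerD//.
  rewrite !big_nat; apply: ler_sum => z /andP[_ zx].
  rewrite mulrC ler_pM2l ?(bd_pi hK)//; last by lia.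
  exact: (cdf_kernel_nonincreasing hK).
rewrite big_nat sumr_ge0// => z /andP[_ zN].
rewrite mulr_ge0//; first exact/ltW/(bd_pi hK).
rewrite /cdf big_nat sumr_ge0// => w /andP[_ wk].
by apply: (kernel_ge0 hK) => //; lia.
Qed.

(** Either [x] is not yet hit, which Chebyshev's inequality controls, or the chain has reached [x]
    and [return_le] bounds a return to [[0, k]]; that bound enters [hitting_barrier] through the
    constant [b]. *)
Lemma upper_tail x t k : (k <= x)%N -> (x <= N)%N -> hit_mean x 0 < t ->
  cdf (H t 0%N) k <= cdf pi k / cdf pi x + hit_var x 0 / (t - hit_mean x 0) ^+ 2.
Proof.
move=> kx xN; set a := hit_mean x 0 => at_.
have a0 : 0 <= a by exact: hit_mean_ge0.
have t0 : 0 <= t by lra.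
have kN : (k <= N)%N by lia.
have c0 : 0 < (t - a) ^+ 2 by rewrite exprn_gt0// subr_gt0.
rewrite -(ler_pM2l c0) mulrDr [X in _ <= _ + X]mulrC divfK ?gt_eqF//.
rewrite (cdf_semigroup _ _ _ kN).
have := @hitting_barrier x t a ((t - a) ^+ 2 * (cdf pi k / cdf pi x)) ((t - a) ^+ 2)
  (fun y => (y <= k)%:R) xN t0.
rewrite subrr expr0n !addr0; apply.
  move=> y yx.
  have h1 := hit_mean_ge0 y xN; have h2 := hit_var_ge0 y xN.
  have h3 : 0 <= (t - a) ^+ 2 * (cdf pi k / cdf pi x).
    by rewrite mulr_ge0 ?ltW// divr_gt0 ?cdf_pi_gt0.
  apply: le_trans (_ : (t - a) ^+ 2 <= _).
    by apply: ler_piMr; [exact: ltW|case: (y <= k)%N; rewrite ?ler01 ?lexx].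
  by nra.
move=> y s /andP[xy yN] /andP[s0 st].
rewrite -cdf_semigroup// -[leLHS]addr0 lerD ?sqr_ge0//.
by rewrite ler_pM2l//; exact: return_le.
Qed.

Definition resistances i x : R := \sum_(i <= k < x) resistance k.

Lemma triangular_sum f g x :
  \sum_(0 <= k < x) f k * \sum_(0 <= j < k.+1) g j =
  \sum_(0 <= j < x) g j * \sum_(j <= k < x) f k.
Proof.
elim: x => [|x IH]; first by rewrite !big_geq.
rewrite big_nat_recr//= IH [RHS]big_nat_recr//= big_nat1.
have -> : \sum_(0 <= j < x) g j * \sum_(j <= k < x.+1) f k =
   \sum_(0 <= j < x) g j * \sum_(j <= k < x) f k + \sum_(0 <= j < x) g j * f x.
  rewrite -big_split/= !big_nat; apply: eq_bigr => j /andP[_ jx].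
  by rewrite big_nat_recr/= ?mulrDr// ltnW.
by rewrite [X in f x * X]big_nat_recr//= mulrDr -mulr_suml; ring.
Qed.

(** After doubling the diagonal terms and exchanging the sums, the term of [j] is
    [resistance j * cdf pi j] times [cdf pi j * resistances j x]; the second factor is at most
    [B]. *)
Lemma hit_var_le x B : (x <= N)%N ->
  (forall i, (i < x)%N -> cdf pi i * resistances i x <= B) ->
  hit_var x 0 <= 2 * B * hit_mean x 0.
Proof.
move=> xN hB; rewrite /hit_var /potential.
have r0 k : (k < x)%N -> 0 <= resistance k.
  by move=> kx; apply/ltW/resistance_gt0; lia.
apply: le_trans (_ : 2 * \sum_(0 <= k < x) resistance k *
    \sum_(0 <= j < k.+1) resistance j * cdf pi j ^+ 2 <= _).
  rewrite mulr_sumr !big_nat; apply: ler_sum => k /andP[_ kx].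
  rewrite [leRHS]mulrCA ler_wpM2l ?r0// big_nat_recr//= mulrDr lerD2l.
  by have := mulr_ge0 (r0 k kx) (sqr_ge0 (cdf pi k)); lra.
rewrite triangular_sum -mulrA ler_pM2l// /hit_mean /potential mulr_sumr.
rewrite !big_nat; apply: ler_sum => j /andP[_ jx].
have := hB j jx; rewrite /resistances.
have := r0 j jx; have := cdf_pi_gt0 (leq_trans (ltnW jx) xN).
set S := \sum_(_ <= _ < _) _; set F := cdf pi j; set r := resistance j.
move=> F0 r0' h; have : 0 <= r * F by rewrite mulr_ge0// ltW.
by nra.
Qed.

End HittingTimes.

(** * Concentration at the ends *)

Section Tails.
Variables (R : realType) (N : nat) (p q pi : nat -> R) (H : R -> nat -> nat -> R).
Hypothesis hK : bd_kernel N p q pi H.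
Implicit Types (f g : nat -> R) (t s a d w B T : R) (x y k m : nat).

(* B is a Muckenhoupt constant, comparable to the relaxation time, and w is
   an upper bound on the cutoff window sqrt (B T). *)
Record chain_scales m B T w : Prop := ChainScales {
  cs_m : (m <= N)%N;
  cs_half_le : 2^-1 <= cdf pi m;
  cs_le_half : forall k, (k < m)%N -> cdf pi k <= 2^-1;
  cs_B : 0 < B;
  cs_hardy : forall i j, (i <= j)%N -> (j < N)%N ->
    cdf pi i * (1 - cdf pi j) * resistances p pi i j.+1 <= B;
  cs_T : hit_mean p pi m 0 <= T;
  cs_Bw : B <= w;
  cs_BT : B * T <= w ^+ 2
}.

Lemma quantile d : d <= 1 -> exists x, [/\ (x <= N)%N, d <= cdf pi x &
  forall k, (k < x)%N -> cdf pi k < d].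
Proof.
move=> d1; have ex : exists x, (x <= N)%N && (d <= cdf pi x).
  by exists N; rewrite leqnn /cdf (bd_sum hK).
have [x /andP[xN dx] xmin] := ex_minnP ex.
exists x; split => // k kx; rewrite ltNge; apply/negP => dk.
by have := xmin k; rewrite dk andbT => /(_ (ltnW (leq_trans kx xN))); rewrite leqNgt kx.
Qed.

Lemma resistances_ge0 i x : (x <= N)%N -> 0 <= resistances p pi i x.
Proof.
move=> xN; rewrite /resistances big_nat sumr_ge0// => k /andP[_ kx].
by apply/ltW/(resistance_gt0 hK); lia.
Qed.

Lemma hit_mean_cat x y : (x <= y)%N ->
  hit_mean p pi y 0 = hit_mean p pi x 0 + \sum_(x <= k < y) resistance p pi k * cdf pi k.
Proof. by move=> xy; rewrite /hit_mean /potential -big_cat_nat. Qed.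

Lemma flux_ge0 x y : (y <= N)%N -> 0 <= \sum_(x <= k < y) resistance p pi k * cdf pi k.
Proof.
move=> yN; rewrite big_nat sumr_ge0// => k /andP[_ ky].
rewrite mulr_ge0//; apply/ltW; first by apply: (resistance_gt0 hK); lia.
by apply: (cdf_pi_gt0 hK); lia.
Qed.

Lemma flux_le_resistances x y : (y <= N)%N ->
  \sum_(x <= k < y) resistance p pi k * cdf pi k <= resistances p pi x y.
Proof.
move=> yN; rewrite /resistances !big_nat; apply: ler_sum => k /andP[_ ky].
rewrite ler_piMr//; first by apply/ltW/(resistance_gt0 hK); lia.
by apply: (cdf_pi_le1 hK); lia.
Qed.

Variables (m : nat) (B T w : R).
Hypothesis hs : chain_scales m B T w.

(** Travelling between two quantiles costs [O(B)]: the flux is at most 1, and the Muckenhoupt bound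
    controls the resistance between them. *)
Lemma middle_flux_le x y c d : (y <= N)%N -> 0 < c -> 0 < d -> c <= cdf pi x ->
  (forall k, (k < y)%N -> d <= 1 - cdf pi k) ->
  \sum_(x <= k < y) resistance p pi k * cdf pi k <= B / (c * d).
Proof.
move=> yN c0 d0 hc hd.
have [xy|yx] := ltnP x y; last first.
  by rewrite big_geq// divr_ge0 ?mulr_ge0 ?ltW// (cs_B hs).
apply: le_trans (flux_le_resistances x yN) _.
rewrite ler_pdivlMr ?mulr_gt0//.
case: y yN hd xy => // y yN hd xy.
apply: le_trans (cs_hardy hs (xy : (x <= y)%N) yN).
rewrite mulrC; apply: ler_wpM2r; first exact: resistances_ge0.
by apply: ler_pM => //; [exact: ltW|exact: ltW|exact: hd].
Qed.

Lemma hit_var_le_tail x d : (x <= N)%N -> 0 < d ->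
  (forall k, (k < x)%N -> d <= 1 - cdf pi k) ->
  hit_var p pi x 0 <= 2 * (B / d) * hit_mean p pi x 0.
Proof.
move=> xN d0 hd; apply: (hit_var_le hK xN) => i ix.
rewrite ler_pdivlMr//; case: x xN hd ix => // x xN hd ix.
apply: le_trans (cs_hardy hs (ix : (i <= x)%N) xN).
have := hd x (ltnSn _); have := resistances_ge0 i xN.
have : 0 < cdf pi i by apply: (cdf_pi_gt0 hK); lia.
move: (resistances _ _ _ _) (cdf pi i) (cdf pi x) => r f g f0 r0 h.
by have := mulr_ge0 (ltW f0) r0; nra.
Qed.

(** The quotient is in fact at most [d ^+ 2 / 6]. *)
Lemma chebyshev_window d v u : 0 < d -> d <= 2^-1 -> v <= 6 / d ^+ 2 * w ^+ 2 ->
  6 / d ^+ 2 * w <= u -> v / u ^+ 2 <= d.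
Proof.
move=> d0 d1 hv hu.
have w0 : 0 < w := lt_le_trans (cs_B hs) (cs_Bw hs).
have u0 : 0 < u by apply: lt_le_trans hu; rewrite mulr_gt0// divr_gt0// exprn_gt0.
rewrite ler_pdivrMr ?exprn_gt0//; apply: le_trans hv _.
apply: le_trans (_ : d * (6 / d ^+ 2 * w) ^+ 2 <= _); last first.
  rewrite ler_pM2l// ler_sqr ?nnegrE ?(ltW u0)//.
  by rewrite ltW// mulr_gt0// divr_gt0// exprn_gt0.
have -> : d * (6 / d ^+ 2 * w) ^+ 2 = (6 / d) * (6 / d ^+ 2 * w ^+ 2).
  by field; rewrite gt_eqF.
rewrite ler_peMl//; first by rewrite mulr_ge0 ?divr_ge0 ?sqr_ge0.
by rewrite ler_pdivlMr// mul1r; lra.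
Qed.

(** Take for [x] the [(1 - d)]-quantile: failing to reach it costs [d], and [cdf pi k / cdf pi x]
    exceeds [cdf pi k] by at most [d]. The 8 is 6 for the Chebyshev gap plus 2 for the shift of the
    mean from [m] to [x]. *)
Lemma start_mixed d t k : 0 < d -> d <= 2^-1 ->
  hit_mean p pi m 0 + 8 / d ^+ 2 * w <= t -> (k <= N)%N ->
  cdf (H t 0%N) k - cdf pi k <= 2 * d.
Proof.
move=> d0 d1 ht kN.
have w0 : 0 < w := lt_le_trans (cs_B hs) (cs_Bw hs).
have t0 : 0 <= t.
  apply: le_trans ht; rewrite addr_ge0 ?(hit_mean_ge0 hK _ (cs_m hs))//.
  by rewrite mulr_ge0 ?ltW// divr_gt0// exprn_gt0.
have [|x [xN dx xmin]] := @quantile (1 - d); first by rewrite gerBl ltW.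
have [kx|xk] := leqP k x; last first.
  have h1 : cdf (H t 0%N) k <= 1.
    by rewrite (cdf_semigroup _ _ _ kN); apply: (semigroup_indicator_le1 hK).
  by have := cdf_pi_le hK (ltnW xk) kN; lra.
have tail j : (j < x)%N -> d <= 1 - cdf pi j by move=> /xmin; lra.
set a := hit_mean p pi x 0.
have ha : a <= hit_mean p pi m 0 + 2 / d * B.
  have [xm|mx] := leqP x m.
    have := hit_mean_cat xm; rewrite -/a => ->.
    have := flux_ge0 x (cs_m hs); have : 0 <= 2 / d * B.
      by rewrite mulr_ge0 ?divr_ge0 ?ltW// (cs_B hs).
    by lra.
  rewrite /a (hit_mean_cat (ltnW mx)) lerD2l.
  apply: le_trans (middle_flux_le xN _ d0 (cs_half_le hs) tail) _ => //.
  by rewrite le_eqVlt; apply/orP; left; apply/eqP; field; rewrite gt_eqF.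
have Bw := cs_Bw hs; have B0 := cs_B hs; have BT := cs_BT hs; have hT := cs_T hs.
have id0 : 0 < d^-1 by rewrite invr_gt0.
have id2 : 2 <= d^-1 by rewrite -[2]invrK lef_pV2 ?posrE ?invr_gt0.
have gap : 6 / d ^+ 2 * w <= t - a.
  have : 2 / d * B <= 2 / d ^+ 2 * w.
    rewrite expr2 invfM mulrA; apply: ler_pM => //.
    - by rewrite mulr_ge0 ?ltW.
    - exact: ltW.
    - by rewrite ler_peMr ?mulr_ge0 ?(ltW id0)//; lra.
  by rewrite (_ : 8 = 6 + 2) in ht; [lra|ring].
have a0 : 0 <= a by exact: (hit_mean_ge0 hK 0 xN).
have var : hit_var p pi x 0 <= 6 / d ^+ 2 * w ^+ 2.
  apply: le_trans (hit_var_le_tail xN d0 tail) _.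
  rewrite -/a.
  have h1 : B * a <= w ^+ 2 + 2 / d * w ^+ 2.
    apply: le_trans (ler_wpM2l (ltW B0) ha) _; rewrite mulrDr lerD//.
      by apply: le_trans BT; rewrite ler_pM2l.
    by rewrite mulrCA ler_pM2l ?mulr_gt0// -expr2 ler_sqr ?nnegrE ?(ltW B0) ?(ltW w0).
  have -> : 2 * (B / d) * a = 2 / d * (B * a) by field; rewrite gt_eqF.
  apply: le_trans (ler_wpM2l _ h1) _; first by rewrite mulr_ge0 ?ltW.
  (* As [d <= 1/2], the sum [2 / d + 4 / d^2] is at most [6 / d^2]; this fixes the 6 of
     [chebyshev_window]. *)
  have -> : 2 / d * (w ^+ 2 + 2 / d * w ^+ 2) = (2 * d^-1 + 4 * (d^-1 * d^-1)) * w ^+ 2.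
    by ring.
  rewrite ler_wpM2r ?sqr_ge0// expr2 invfM.
  by nra.
have pos : 0 < 6 / d ^+ 2 * w by rewrite mulr_gt0 ?divr_gt0 ?exprn_gt0.
have at_ : a < t by lra.
have := upper_tail hK kx xN at_; rewrite -/a.
have := chebyshev_window d0 d1 var gap.
have Fx0 := cdf_pi_gt0 hK xN.
have : cdf pi k / cdf pi x - cdf pi k <= d.
  have h : cdf pi k / cdf pi x <= 1 by rewrite ler_pdivrMr// mul1r (cdf_pi_le hK).
  have -> : cdf pi k / cdf pi x - cdf pi k = cdf pi k / cdf pi x * (1 - cdf pi x).
    by field; rewrite gt_eqF.
  apply: le_trans (_ : 1 * (1 - cdf pi x) <= _); last by lra.
  by rewrite ler_wpM2r// subr_ge0 (cdf_pi_le1 hK).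
by lra.
Qed.

(** Here [x] is the [d]-quantile. It is excluded from the set of small mass because it may itself be
    a large atom; hitting it late still keeps the chain strictly below. *)
Lemma start_unmixed d t : 0 < d -> d <= 2^-1 -> 0 <= t ->
  t <= hit_mean p pi m 0 - 8 / d ^+ 2 * w ->
  exists x, [/\ (x <= m)%N, \sum_(0 <= y < x) pi y <= d &
    \sum_(x <= y < N.+1) H t 0%N y <= d].
Proof.
move=> d0 d1 t0 ht.
have w0 : 0 < w := lt_le_trans (cs_B hs) (cs_Bw hs).
have mN := cs_m hs.
have [|x [xN dx xmin]] := @quantile d; first by lra.
have xm : (x <= m)%N.
  rewrite leqNgt; apply/negP => /xmin; have := cs_half_le hs; lra.
exists x; split => //.
  case: x {xN dx xm} xmin => [|x] xmin; first by rewrite big_geq ?ltW.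
  exact/ltW/(xmin x).
have tail j : (j < m)%N -> 2^-1 <= 1 - cdf pi j by move=> /(cs_le_half hs); lra.
set a := hit_mean p pi x 0.
have Bw := cs_Bw hs; have B0 := cs_B hs; have BT := cs_BT hs; have hT := cs_T hs.
have id0 : 0 < d^-1 by rewrite invr_gt0.
have id2 : 2 <= d^-1 by rewrite -[2]invrK lef_pV2 ?posrE ?invr_gt0.
have ha : hit_mean p pi m 0 <= a + 2 / d * B.
  rewrite (hit_mean_cat xm) lerD2l.
  apply: le_trans (middle_flux_le mN d0 _ dx tail) _; first by rewrite invr_gt0.
  by rewrite le_eqVlt; apply/orP; left; apply/eqP; field; rewrite gt_eqF.
have gap : 6 / d ^+ 2 * w <= a - t.
  have : 2 / d * B <= 2 / d ^+ 2 * w.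
    rewrite expr2 invfM mulrA; apply: ler_pM => //.
    - by rewrite mulr_ge0 ?ltW.
    - exact: ltW.
    - by rewrite ler_peMr ?mulr_ge0 ?(ltW id0)//; lra.
  by rewrite (_ : 8 = 6 + 2) in ht; [lra|ring].
have pos : 0 < 6 / d ^+ 2 * w by rewrite mulr_gt0 ?divr_gt0 ?exprn_gt0.
have ta : t < a by lra.
have am : a <= hit_mean p pi m 0.
  by rewrite (hit_mean_cat xm) lerDl flux_ge0.
apply: le_trans (lower_tail hK xN t0 ta) _.
apply: chebyshev_window => //.
apply: le_trans (hit_var_le_tail xN _ (fun j jx => tail j (leq_trans jx xm))) _ => //.
rewrite -/a invrK.
have -> : 2 * (B * 2) * a = 4 * (B * a) by ring.
have h1 : B * a <= w ^+ 2 by apply: le_trans BT; rewrite ler_pM2l//; lra.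
apply: le_trans (ler_wpM2l _ h1) _ => //.
by rewrite ler_wpM2r ?sqr_ge0// expr2 invfM; nra.
Qed.

End Tails.

(** * Reflection and worst-case distances *)

Section Reflection.
Variables (R : realType) (N : nat).
Implicit Types (f g : nat -> R) (k x y : nat).

Definition reflect (T : Type) (f : nat -> T) k := f (N - k)%N.

Lemma sum_reflect f : \sum_(0 <= y < N.+1) reflect f y = \sum_(0 <= y < N.+1) f y.
Proof.
by rewrite [RHS]big_nat_rev/=; apply: eq_bigr => k _; rewrite add0n subSS.
Qed.

Lemma sum_reflect_range f x y : (x <= y)%N -> (y <= N)%N ->
  \sum_(x <= k < y) f (N - k.+1)%N = \sum_(N - y <= k < N - x) f k.
Proof.
move=> xy; elim: y xy => [|y IH]; first by rewrite leqn0 => /eqP -> _; rewrite !big_geq.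
rewrite leq_eqVlt => /orP[/eqP ->|xy yN]; first by rewrite !big_geq.
rewrite big_nat_recr//= IH//; last exact: ltnW.
rewrite [RHS]big_ltn; last by lia.
rewrite addrC.
by have -> : ((N - y.+1).+1 = N - y)%N by lia.
Qed.

Lemma cdf_reflect f k : (k < N)%N ->
  cdf (reflect f) k = \sum_(0 <= y < N.+1) f y - cdf f (N - k.+1).
Proof.
move=> kN; have e := sum_split f (leq_subr k.+1 N).
rewrite e addrC addrA addNr add0r /cdf.
have -> : ((N - k.+1).+1 = N - k)%N by lia.
rewrite big_nat_recl//= /reflect subn0.
rewrite [RHS](big_nat_recr)/=; last by lia.
rewrite addrC; congr (_ + _).
by rewrite sum_reflect_range// ?subn0// ltnW.
Qed.

End Reflection.

Section Ends.
Variables (R : realType) (N : nat) (p q pi : nat -> R) (H : R -> nat -> nat -> R).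
Hypothesis hK : bd_kernel N p q pi H.
Implicit Types (f g : nat -> R) (t s d : R) (x y k : nat).

Definition tv f g : R := 2^-1 * \sum_(0 <= y < N.+1) `|f y - g y|.

Lemma tv_reflect f g : tv (reflect N f) (reflect N g) = tv f g.
Proof. by rewrite /tv -[in RHS]sum_reflect. Qed.

Lemma cdf_le_tv f g k : (k <= N)%N ->
  \sum_(0 <= y < N.+1) f y = \sum_(0 <= y < N.+1) g y -> cdf f k - cdf g k <= tv f g.
Proof.
move=> kN; rewrite /tv !(sum_split _ kN) => e.
have h1 : cdf f k - cdf g k <= cdf (fun y => `|f y - g y|) k.
  by rewrite /cdf -sumrB; apply: ler_sum => y _; exact: ler_norm.
have h2 : \sum_(k.+1 <= y < N.+1) g y - \sum_(k.+1 <= y < N.+1) f y <=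
   \sum_(k.+1 <= y < N.+1) `|f y - g y|.
  by rewrite -sumrB; apply: ler_sum => y _; rewrite distrC ler_norm.
by lra.
Qed.

Lemma tvC f g : tv f g = tv g f.
Proof. by rewrite /tv; under eq_bigr do rewrite distrC. Qed.

Notation p' := (fun k => q (N - k)%N).
Notation q' := (fun k => p (N - k)%N).
Notation pi' := (reflect N pi).
Notation H' := (fun t x y => H t (N - x)%N (N - y)%N).

Let hK' : bd_kernel N p' q' pi' H' := bd_kernel_reflect hK.

Lemma resistance_reflect k : (k < N)%N ->
  resistance p' pi' k = resistance p pi (N - k.+1).
Proof.
move=> kN; rewrite /resistance /reflect (bd_rev hK); last by lia.
by have -> : ((N - k.+1).+1 = N - k)%N by lia.
Qed.

Lemma cdf_pi_reflect k : (k < N)%N -> cdf pi' k = 1 - cdf pi (N - k.+1).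
Proof. by move=> kN; rewrite cdf_reflect// (bd_sum hK). Qed.

Lemma resistances_reflect i x : (i <= x)%N -> (x <= N)%N ->
  resistances p' pi' i x = resistances p pi (N - x) (N - i).
Proof.
move=> ix xN; rewrite /resistances -sum_reflect_range// !big_nat.
by apply: eq_bigr => k /andP[_ kx]; rewrite resistance_reflect//; lia.
Qed.

Variables (m : nat) (B w : R).

Definition start_mean := hit_mean p pi m 0.
Definition end_mean := hit_mean p' pi' (N - m) 0.

Lemma end_meanE : (m <= N)%N ->
  end_mean = \sum_(m <= k < N) resistance p pi k * (1 - cdf pi k).
Proof.
move=> mN; rewrite /end_mean /hit_mean /potential.
transitivity (\sum_(0 <= k < N - m)
    resistance p pi (N - k.+1) * (1 - cdf pi (N - k.+1))).
  rewrite !big_nat; apply: eq_bigr => k /andP[_ km].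
  by rewrite resistance_reflect ?cdf_pi_reflect//; lia.
rewrite (sum_reflect_range (fun k => resistance p pi k * (1 - cdf pi k))) ?leq_subr//.
by rewrite subKn// subn0.
Qed.

Lemma start_mean_ge0 : (m <= N)%N -> 0 <= start_mean.
Proof. by move=> mN; exact: (hit_mean_ge0 hK). Qed.

Lemma end_mean_ge0 : 0 <= end_mean.
Proof. exact: (hit_mean_ge0 hK' _ (leq_subr _ _)). Qed.

Hypothesis hs : chain_scales N p pi m B (start_mean + end_mean) w.

(** Reflection swaps the two median conditions and the factors [F(i)] and [1 - F(j)], so the same
    [B] and [w] serve both ends. *)
Lemma chain_scales_reflect :
  chain_scales N p' pi' (N - m) B (start_mean + end_mean) w.
Proof.
have [mN h1 h2 h3 h4 h5 h6 h7] := hs.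
split => //.
- exact: leq_subr.
- have [m0|m0] := posnP m.
    by rewrite m0 subn0 /cdf (bd_sum hK') invf_le1// ler1n.
  rewrite cdf_pi_reflect; last by lia.
  have -> : (N - (N - m).+1 = m.-1)%N by lia.
  by have := h2 m.-1; rewrite prednK// leqnn => /(_ isT); lra.
- move=> k km; rewrite cdf_pi_reflect; last by lia.
  apply: le_trans (_ : 1 - cdf pi m <= _); last by lra.
  by rewrite lerD2l lerN2; apply: (cdf_pi_le hK); lia.
- move=> i j ij jN; rewrite !cdf_pi_reflect; [|lia|lia].
  rewrite resistances_reflect//; last by lia.
  have hh : (N - j.+1 <= N - i.+1)%N by lia.
  have hh2 : (N - i.+1 < N)%N by lia.
  have := h4 _ _ hh hh2.
  have -> : ((N - i.+1).+1 = N - i)%N by lia.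
  rewrite opprB addrCA subrr addr0.
  by rewrite [X in X * _]mulrC.
- by rewrite -/end_mean lerDr start_mean_ge0.
Qed.

Let hs' := chain_scales_reflect.

Lemma tv_start d t : 0 < d -> d <= 2^-1 -> start_mean + 8 / d ^+ 2 * w <= t ->
  tv (H t 0%N) pi <= 2 * d.
Proof.
move=> d0 d1 ht.
have w0 : 0 < w := lt_le_trans (cs_B hs) (cs_Bw hs).
have t0 : 0 <= t.
  apply: le_trans ht; rewrite addr_ge0 ?start_mean_ge0 ?(cs_m hs)//.
  by rewrite mulr_ge0 ?ltW// divr_gt0// exprn_gt0.
have [k kN] := tv_start_crossing hK t0.
by rewrite /tv => ->; exact: (start_mixed hK hs d0 d1 ht kN).
Qed.

(** The density is nonincreasing, so its value [a] at [m] bounds it on [[m, N]] and is a lower bound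
    on [[x, m]]. There [pi] has mass at least [1/2 - d >= 1/4] and the chain at most [d]. *)
Lemma low_density_start d s y : 0 < d -> d <= 4^-1 -> 0 <= s ->
  s <= start_mean - 8 / d ^+ 2 * w -> (m <= y)%N -> (y <= N)%N ->
  H s 0%N y / pi y <= 4 * d.
Proof.
move=> d0 d1 s0 hsd my yN.
have mN := cs_m hs.
have [|x [xm h1 h2]] := start_unmixed hK hs d0 _ s0 hsd; first by lra.
apply: le_trans (density_start_nonincreasing hK my yN s0) _.
set a := H s 0%N m / pi m.
have a0 : 0 <= a.
  by apply: divr_ge0; [exact: (kernel_ge0 hK)|exact/ltW/(bd_pi hK)].
have : a * \sum_(x <= z < m.+1) pi z <= d.
  apply: le_trans h2; rewrite [leRHS](big_cat_nat _ (n := m.+1))//=; last by lia.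
  rewrite mulr_sumr -[leLHS]addr0 lerD//.
    rewrite !big_nat; apply: ler_sum => z /andP[_ zm].
    rewrite -ler_pdivlMr ?(bd_pi hK)//; last by lia.
    by apply: (density_start_nonincreasing hK); lia.
  by rewrite big_nat sumr_ge0// => z /andP[_ zN]; exact: (kernel_ge0 hK).
have : 4^-1 <= \sum_(x <= z < m.+1) pi z.
  have := cs_half_le hs; rewrite /cdf (big_cat_nat _ (n := x))//=; last by lia.
  by lra.
move: (\sum_(_ <= _ < _) _) => S hS; nra.
Qed.

End Ends.

(** * Total variation and separation over all starting points *)

Section WorstCase.
Variables (R : realType) (N : nat) (p q pi : nat -> R) (H : R -> nat -> nat -> R).
Hypothesis hK : bd_kernel N p q pi H.
Implicit Types (f g : nat -> R) (t s d : R) (x y k : nat).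
Variables (m : nat) (B w : R).
Notation T0 := (start_mean p pi m).
Notation TN := (end_mean N q pi m).
Hypothesis hs : chain_scales N p pi m B (T0 + TN) w.

Notation p' := (fun k => q (N - k)%N).
Notation q' := (fun k => p (N - k)%N).
Notation pi' := (reflect N pi).
Notation H' := (fun t x y => H t (N - x)%N (N - y)%N).

Let hK' : bd_kernel N p' q' pi' H' := bd_kernel_reflect hK.

Let mN : (m <= N)%N := cs_m hs.

Lemma start_mean_reflect : start_mean p' pi' (N - m) = TN.
Proof. by []. Qed.

Lemma end_mean_reflect : end_mean N q' pi' (N - m) = T0.
Proof.
rewrite (end_meanE hK' (leq_subr _ _)) /start_mean /hit_mean /potential.
rewrite -[in RHS](subKn mN) -[in RHS](subnn N) -sum_reflect_range ?leq_subr//.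
rewrite !big_nat; apply: eq_bigr => k /andP[mk kN].
rewrite (resistance_reflect hK)// (cdf_pi_reflect hK)//; congr (_ * _); ring.
Qed.

Let hs' : chain_scales N p' pi' (N - m) B
  (start_mean p' pi' (N - m) + end_mean N q' pi' (N - m)) w.
Proof.
rewrite start_mean_reflect end_mean_reflect addrC.
exact: (chain_scales_reflect hK hs).
Qed.

Lemma tv_end d t : 0 < d -> d <= 2^-1 -> TN + 8 / d ^+ 2 * w <= t ->
  tv N (H t N) pi <= 2 * d.
Proof.
move=> d0 d1 ht; have := tv_start hK' hs' d0 d1 ht.
have -> : (fun y => H t (N - 0)%N (N - y)%N) = reflect N (H t N) by rewrite subn0.
by rewrite tv_reflect.
Qed.

Lemma low_density_end d s y : 0 < d -> d <= 4^-1 -> 0 <= s ->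
  s <= TN - 8 / d ^+ 2 * w -> (y <= m)%N -> H s N y / pi y <= 4 * d.
Proof.
move=> d0 d1 s0 hsd ym.
have := low_density_start hK' hs' d0 d1 s0 hsd (leq_sub2l N ym) (leq_subr _ _).
by rewrite /reflect subKn ?subn0//; lia.
Qed.

Lemma tv_worst_le d t x : 0 < d -> d <= 2^-1 -> (x <= N)%N ->
  T0 + 8 / d ^+ 2 * w <= t -> TN + 8 / d ^+ 2 * w <= t ->
  tv N (H t x) pi <= 6 * d.
Proof.
move=> d0 d1 xN h0 hN.
have w0 : 0 < w := lt_le_trans (cs_B hs) (cs_Bw hs).
have t0 : 0 <= t.
  apply: le_trans h0; rewrite addr_ge0 ?(start_mean_ge0 hK)//.
  by rewrite mulr_ge0 ?ltW// divr_gt0// exprn_gt0.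
have := @tv_start_le _ _ _ _ _ _ hK t x (2 * d) (2 * d) xN t0.
rewrite -/(tv N _ _) => h; apply: le_trans (h _ _) _; last by lra.
  move=> k kN; apply: le_trans (tv_start hK hs d0 d1 h0); apply: cdf_le_tv => //.
  by rewrite (kernel_sum1 hK)// (bd_sum hK).
move=> k kN; apply: le_trans (tv_end d0 d1 hN); rewrite tvC; apply: cdf_le_tv => //.
by rewrite (kernel_sum1 hK)// (bd_sum hK).
Qed.

Lemma tv_start_ge d t : 0 < d -> d <= 2^-1 -> 0 <= t ->
  t <= T0 - 8 / d ^+ 2 * w -> 1 - 2 * d <= tv N (H t 0%N) pi.
Proof.
move=> d0 d1 t0 ht.
have [x [xm h1 h2]] := start_unmixed hK hs d0 d1 t0 ht.
have e1 := kernel_sum1 hK (leq0n N) t0; have e2 := bd_sum hK.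
(* [x = 0] would put the whole mass of [H t 0] in the tail, against [d <= 1/2]. *)
case: x xm h1 h2 => [|x] xm h1 h2.
  by rewrite e1 in h2; lra.
have xN : (x <= N)%N by lia.
have := @cdf_le_tv R N (H t 0%N) pi x xN; rewrite e1 e2 => /(_ erefl).
move: e1 h2; rewrite (sum_split _ xN) => e1 h2.
by move: h1; rewrite -/(cdf pi x); lra.
Qed.

End WorstCase.

Section WorstCaseBounds.
Variables (R : realType) (N : nat) (p q pi : nat -> R) (H : R -> nat -> nat -> R).
Hypothesis hK : bd_kernel N p q pi H.
Implicit Types (f g : nat -> R) (t s d : R) (x y k : nat).
Variables (m : nat) (B w : R).
Notation T0 := (start_mean p pi m).
Notation TN := (end_mean N q pi m).
Hypothesis hs : chain_scales N p pi m B (T0 + TN) w.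

Lemma tv_worst_ge d t : 0 < d -> d <= 2^-1 -> 0 <= t ->
  t <= Num.max T0 TN - 8 / d ^+ 2 * w ->
  exists2 x, (x <= N)%N & 1 - 2 * d <= tv N (H t x) pi.
Proof.
move=> d0 d1 t0; rewrite /Num.max; case: ifP => _ ht; last first.
  by exists 0%N => //; exact: (tv_start_ge hK hs).
exists N => //.
have hs' := chain_scales_reflect hK hs.
have e := end_mean_reflect hK hs.
have hs'' : chain_scales N (fun k => q (N - k)%N) (reflect N pi) (N - m) B
   (start_mean (fun k => q (N - k)%N) (reflect N pi) (N - m) +
    end_mean N (fun k => p (N - k)%N) (reflect N pi) (N - m)) w.
  by rewrite e start_mean_reflect addrC.
have := tv_start_ge (bd_kernel_reflect hK) hs'' d0 d1 t0 ht.
have -> : (fun y => H t (N - 0)%N (N - y)%N) = reflect N (H t N) by rewrite subn0.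
by rewrite tv_reflect.
Qed.

(** Splitting at [T0 + c] makes both end chains mixed to within [2 * d], so the corner density is at
    least [1 - 4 * d]; [density_ge] with [e = 4 * d] leaves
    [(1 - 4 * d) / (1 + 4 * d) >= 1 - 8 * d]. *)
Lemma density_worst_ge d t x y : 0 < d -> d <= 2^-1 -> (x <= N)%N -> (y <= N)%N ->
  T0 + TN + 2 * (8 / d ^+ 2 * w) <= t -> 1 - H t x y / pi y <= 8 * d.
Proof.
move=> d0 d1 xN yN ht.
have w0 : 0 < w := lt_le_trans (cs_B hs) (cs_Bw hs).
have T00 := start_mean_ge0 hK (cs_m hs); have TN0 := end_mean_ge0 hK m.
move: ht; set c := 8 / d ^+ 2 * w => ht.
have c0 : 0 <= c by rewrite mulr_ge0 ?ltW// divr_gt0// exprn_gt0.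
have t0 : 0 <= t by lra.
have hs0 : T0 + 8 / d ^+ 2 * w <= T0 + c by [].
have hsN : TN + 8 / d ^+ 2 * w <= t - (T0 + c) by rewrite -/c; lra.
have s0 : 0 <= T0 + c by rewrite addr_ge0.
have sN : 0 <= t - (T0 + c) by lra.
have := density_ends_ge hK s0 sN (tv_start hK hs d0 d1 hs0) (tv_end hK hs d0 d1 hsN).
have -> : T0 + c + (t - (T0 + c)) = t by ring.
move=> h1.
have h0t : T0 + 8 / d ^+ 2 * w <= t by rewrite -/c; lra.
have hNt : TN + 8 / d ^+ 2 * w <= t by rewrite -/c; lra.
have sum1 z : (z <= N)%N -> \sum_(0 <= y < N.+1) H t z y = \sum_(0 <= y < N.+1) pi y.
  by move=> zN; rewrite (kernel_sum1 hK)// (bd_sum hK).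
have k1 := le_trans (cdf_le_tv yN (sum1 0%N (leq0n N))) (tv_start hK hs d0 d1 h0t).
have k2 := cdf_le_tv yN (esym (sum1 N (leqnn N))); rewrite tvC in k2.
have k3 := le_trans k2 (tv_end hK hs d0 d1 hNt).
have he : cdf (H t 0%N) y - cdf (H t N) y <= 4 * d by lra.
have := density_ge hK xN yN t0 he.
by move: h1; move: (_ / _) (_ / _) => a b h1 h2; nra.
Qed.

(** Splitting at [T0 - c] leaves both end chains unmixed. A midpoint [y <= m] has low density from
    [N], one beyond [m] low density from [0], so each term is at most [4 * d] times the mass of the
    other kernel. The two initial cases ensure that both times are nonnegative. *)
Lemma density_ends_le d t : 0 < d -> d <= 4^-1 -> 0 <= t ->
  t < T0 + TN - 2 * (8 / d ^+ 2 * w) -> H t 0%N N / pi N <= 8 * d.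
Proof.
move=> d0 d1 t0; set c := 8 / d ^+ 2 * w => ht.
have [h|h] := leP t (T0 - c).
  by have := low_density_start hK hs d0 d1 t0 h (cs_m hs) (leqnn N); lra.
have [h'|h'] := leP t (TN - c).
  have := low_density_end hK hs d0 d1 t0 h' (leq0n m).
  by rewrite (density_sym hK)//; lra.
have s0 : 0 <= T0 - c by lra.
have s'0 : 0 <= t - (T0 - c) by lra.
have hs0 : T0 - c <= T0 - 8 / d ^+ 2 * w by [].
have hsN : t - (T0 - c) <= TN - 8 / d ^+ 2 * w by rewrite -/c; lra.
have -> : t = (T0 - c) + (t - (T0 - c)) by ring.
rewrite (kernel_chapman hK)// mulr_suml.
have e1 := kernel_sum1 hK (leq0n N) s0.
have e2 := kernel_sum1 hK (leqnn N) s'0.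
have -> : 8 * d = \sum_(0 <= y < N.+1)
    4 * d * (H (T0 - c) 0%N y + H (t - (T0 - c)) N y).
  by rewrite -mulr_sumr big_split/= e1 e2; ring.
rewrite !big_nat; apply: ler_sum => y /andP[_ yN].
have yN' : (y <= N)%N by [].
rewrite -mulrA (density_sym hK yN' (leqnn N) s'0).
have a0 := kernel_ge0 hK (leq0n N) yN' s0.
have b0 := kernel_ge0 hK (leqnn N) yN' s'0.
have [ym|my] := leqP y m.
  have := low_density_end hK hs d0 d1 s'0 hsN ym.
  by move: (H _ 0%N y) (H _ N y) (_ / _) a0 b0 => a b r a0 b0 hr; nra.
have := low_density_start hK hs d0 d1 s0 hs0 (ltnW my) yN'.
rewrite mulrCA; rewrite [_ * (_ / _)]mulrC.
move: (H _ 0%N y) (H _ N y) (H _ 0%N y / _) a0 b0 => a b r a0 b0 hr.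
by nra.
Qed.

End WorstCaseBounds.

(** * Exponential lower bound *)

Section Relaxation.
Variables (R : realType) (N : nat) (p q pi : nat -> R) (H : R -> nat -> nat -> R).
Hypothesis hK : bd_kernel N p q pi H.
Implicit Types (f g : nat -> R) (t s u e : R) (x y k : nat).

Definition inner f g : R := \sum_(0 <= x < N.+1) pi x * f x * g x.

Definition energy f : R := \sum_(0 <= k < N) pi k * p k * (f k.+1 - f k) ^+ 2.

Let pi0 y : (y < N.+1)%N -> 0 < pi y. Proof. by move=> yN; exact: (bd_pi hK). Qed.

Lemma inner_sqr_ge0 f : 0 <= inner f f.
Proof.
rewrite /inner big_nat sumr_ge0// => x /andP[_ xN].
by rewrite -mulrA mulr_ge0 ?(ltW (pi0 xN))// -expr2 sqr_ge0.
Qed.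

Lemma inner_cauchy_schwarz f g : inner f g ^+ 2 <= inner f f * inner g g.
Proof.
rewrite -subr_ge0.
have -> : inner f f * inner g g - inner f g ^+ 2 =
   2^-1 * \sum_(0 <= x < N.+1) \sum_(0 <= y < N.+1)
     pi x * pi y * (f x * g y - f y * g x) ^+ 2.
  have prod (a b c d : nat -> R) : inner a b * inner c d =
      \sum_(0 <= x < N.+1) \sum_(0 <= y < N.+1) pi x * pi y * (a x * b x * (c y * d y)).
    rewrite /inner mulr_suml; apply: eq_bigr => x _.
    by rewrite mulr_sumr; apply: eq_bigr => y _; ring.
  have -> : inner f f * inner g g - inner f g ^+ 2 =
     2^-1 * (inner f f * inner g g + inner g g * inner f f - 2 * (inner f g * inner f g)).
    by rewrite expr2; field.
  rewrite !prod; congr (_ * _).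
  rewrite mulr_sumr -big_split -sumrB/=; apply: eq_bigr => x _.
  rewrite mulr_sumr -big_split -sumrB/=; apply: eq_bigr => y _.
  by ring.
rewrite mulr_ge0// big_nat sumr_ge0// => x /andP[_ xN].
rewrite big_nat sumr_ge0// => y /andP[_ yN].
by rewrite mulr_ge0 ?sqr_ge0// mulr_ge0// ltW// pi0.
Qed.

(** Self-adjointness moves [t] to the other factor; with Cauchy-Schwarz this is log-convexity of the
    squared norm in time. *)
Lemma semigroup_inner s t f : 0 <= s -> 0 <= t ->
  inner (semigroup N H (s + t) f) (semigroup N H (s + t) f) =
  inner (semigroup N H s f) (semigroup N H (s + 2 * t) f).
Proof.
move=> s0 t0.
have st0 : 0 <= s + t by rewrite addr_ge0.
have e1 : inner (semigroup N H (s + t) f) (semigroup N H (s + t) f) =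
    inner (semigroup N H t (semigroup N H s f)) (semigroup N H (s + t) f).
  rewrite /inner !big_nat; apply: eq_bigr => x /andP[_ xN].
  by congr (_ * _ * _); rewrite addrC (semigroupD hK).
rewrite e1 {1}/inner (semigroup_selfadjoint hK _ _ t0) /inner.
rewrite !big_nat; apply: eq_bigr => x /andP[_ xN]; congr (_ * _).
by rewrite -(semigroupD hK)//; congr semigroup; ring.
Qed.

Lemma is_derive_inner_sqr f s :
  is_derive s 1 (fun s => inner (semigroup N H s f) (semigroup N H s f))
    (- 2 * energy (semigroup N H s f)).
Proof.
have h : is_derive s 1
    (fun s => \sum_(0 <= x < N.+1 | (0 <= x < N.+1)%N)
        pi x * semigroup N H s f x * semigroup N H s f x)
    (\sum_(0 <= x < N.+1 | (0 <= x < N.+1)%N)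
       2 * (pi x * generator p q (semigroup N H s f) x * semigroup N H s f x)).
  apply: is_derive_bigsum => x /andP[_ xN].
  have h1 := heat_semigroup hK f s (xN : (x <= N)%N).
  by apply: (is_derive_eq (is_derive_mul (is_derive_scale (pi x) h1) h1)); ring.
rewrite /inner; under [X in is_derive _ _ X _]funext => s' do rewrite big_nat.
apply: (is_derive_eq h); rewrite -big_nat -mulr_sumr (dirichlet_form hK) mulrN mulNr.
by congr (- (_ * _)); rewrite /energy; apply: eq_bigr => k _; rewrite expr2; ring.
Qed.

Lemma energy_nonincreasing f s : 0 <= s ->
  energy (semigroup N H s f) <= energy (semigroup N H 0 f).
Proof.
move=> s0.
pose dE s := - 2 * inner (generator p q (semigroup N H s f)) (generator p q (semigroup N H s f)).
apply: (@nonincreasing_of_derive R (fun s => energy (semigroup N H s f)) dE 0 s s0).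
  move=> t.
  pose g := semigroup N H t f.
  have h : is_derive t 1
      (fun s => \sum_(0 <= k < N | (0 <= k < N)%N)
         pi k * p k * (semigroup N H s f k.+1 - semigroup N H s f k) ^+ 2)
      (\sum_(0 <= k < N | (0 <= k < N)%N) 2 * (pi k * p k * (g k.+1 - g k) *
         (generator p q g k.+1 - generator p q g k))).
    apply: is_derive_bigsum => k /andP[_ kN].
    have h1 := is_derive_sub (heat_semigroup hK f t (kN : (k.+1 <= N)%N))
      (heat_semigroup hK f t (ltnW kN)).
    by apply: (is_derive_eq (is_derive_scale (pi k * p k) (is_derive_mul h1 h1))); rewrite /g; ring.
  rewrite /energy; under [X in is_derive _ _ X _]funext => s' do rewrite big_nat.
  apply: (is_derive_eq h); rewrite -big_nat -mulr_sumr /dE /inner -/g.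
  by rewrite (dirichlet_form hK); ring.
by move=> t _; rewrite /dE mulNr oppr_le0 mulr_ge0// inner_sqr_ge0.
Qed.

(** The squared norm decays at rate twice the energy, which never exceeds its initial value. *)
Lemma inner_decay_ge f u : 0 <= u ->
  inner f f - 2 * u * energy f <= inner (semigroup N H u f) (semigroup N H u f).
Proof.
move=> u0.
have e0 : energy (semigroup N H 0 f) = energy f.
  rewrite /energy !big_nat; apply: eq_bigr => k /andP[_ kN].
  by rewrite !(semigroup0 hK)// ltnW.
have i0 : inner (semigroup N H 0 f) (semigroup N H 0 f) = inner f f.
  rewrite /inner !big_nat; apply: eq_bigr => k /andP[_ kN].
  by rewrite !(semigroup0 hK).
pose F s := - (2 * energy f) * s - inner (semigroup N H s f) (semigroup N H s f).
have hF s : is_derive s 1 F (- (2 * energy f) * 1 - - 2 * energy (semigroup N H s f)).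
  exact: (is_derive_sub (is_derive_scale _ (is_derive_id s 1)) (is_derive_inner_sqr f s)).
have := nonincreasing_of_derive u0 hF.
rewrite /F mulr0 sub0r i0 => h.
have : forall t, 0 <= t <= u ->
    - (2 * energy f) * 1 - - 2 * energy (semigroup N H t f) <= 0.
  by move=> t /andP[t0 _]; have := energy_nonincreasing f t0; rewrite e0; lra.
by move=> /h; lra.
Qed.

(** By log-convexity the successive ratios are nondecreasing, so all are at least [1/2] once the
    first one is. *)
Lemma geometric_decay f u k : 0 <= u -> 0 < inner f f ->
  2 * (2 * u * energy f) <= inner f f ->
  inner f f / 2 ^+ k <=
    inner (semigroup N H (k%:R * u) f) (semigroup N H (k%:R * u) f).
Proof.
move=> u0 f0 hu.
pose a k := inner (semigroup N H (k%:R * u) f) (semigroup N H (k%:R * u) f).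
have a0 : a 0%N = inner f f.
  rewrite /a mul0r /inner !big_nat; apply: eq_bigr => x /andP[_ xN].
  by rewrite !(semigroup0 hK).
have step n : 0 < a n /\ a n <= 2 * a n.+1.
  elim: n => [|n [an han]].
    rewrite a0; split => //; rewrite /a mul1r.
    by have := inner_decay_ge f u0; lra.
  have an1 : 0 < a n.+1 by lra.
  split => //.
  have cs : a n.+1 ^+ 2 <= a n * a n.+2.
    have := inner_cauchy_schwarz (semigroup N H (n%:R * u) f) (semigroup N H (n.+2%:R * u) f).
    have nu0 : 0 <= n%:R * u by rewrite mulr_ge0.
    have e2 : n.+2%:R * u = n%:R * u + 2 * u by rewrite -addn2 natrD mulrDl.
    rewrite e2 -(semigroup_inner f nu0 u0).
    have -> : n%:R * u + u = n.+1%:R * u by rewrite -addn1 natrD mulrDl mul1r.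
    by rewrite /a e2.
  have h1 : a n * a n.+1 <= a n * (2 * a n.+2).
    apply: le_trans (_ : 2 * a n.+1 * a n.+1 <= _); first by rewrite ler_pM2r.
    by have := cs; rewrite expr2; lra.
  by rewrite ler_pM2l in h1.
rewrite -/(a k); elim: k => [|k IH]; first by rewrite a0 expr0 divr1.
have [_ h] := step k.
rewrite exprS invfM mulrCA ler_pdivrMl//; exact: le_trans h.
Qed.

(** A mean-zero [f] is not affected by subtracting [pi] from the kernel, and the difference has
    total mass at most [2 * e]. *)
Lemma tv_contraction t e f M x : 0 <= t ->
  (forall x, (x <= N)%N -> tv N (H t x) pi <= e) ->
  \sum_(0 <= y < N.+1) pi y * f y = 0 -> 0 <= M ->
  (forall y, (y <= N)%N -> `|f y| <= M) -> (x <= N)%N ->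
  `|semigroup N H t f x| <= 2 * e * M.
Proof.
move=> t0 he f0 M0 fM xN.
have -> : semigroup N H t f x = \sum_(0 <= y < N.+1) (H t x y - pi y) * f y.
  under eq_bigr => y _ do rewrite mulrBl.
  by rewrite sumrB f0 subr0.
apply: le_trans (ler_norm_sum _ _ _) _.
apply: le_trans (_ : (\sum_(0 <= y < N.+1) `|H t x y - pi y|) * M <= _).
  rewrite mulr_suml !big_nat; apply: ler_sum => y /andP[_ yN].
  by rewrite normrM ler_wpM2l// fM.
by rewrite ler_wpM2r//; have := he x xN; rewrite /tv; lra.
Qed.

Lemma tv_iterate t e f n x : 0 <= t -> 0 <= e ->
  (forall x, (x <= N)%N -> tv N (H t x) pi <= e) ->
  \sum_(0 <= y < N.+1) pi y * f y = 0 ->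
  (forall y, (y <= N)%N -> `|f y| <= 1) -> (x <= N)%N ->
  `|semigroup N H (n%:R * t) f x| <= (2 * e) ^+ n.
Proof.
move=> t0 e0 he f0 f1; elim: n x => [|n IH] x xN.
  by rewrite mul0r (semigroup0 hK)// expr0 f1.
have -> : n.+1%:R * t = t + n%:R * t by rewrite -addn1 natrD mulrDl mul1r addrC.
have nt0 : 0 <= n%:R * t by rewrite mulr_ge0.
rewrite (semigroupD hK)// exprS; apply: tv_contraction => //.
  have := semigroup_selfadjoint hK f (fun=> 1) nt0.
  under eq_bigr => y _ do rewrite mulr1.
  move=> ->; rewrite -[RHS]f0 !big_nat; apply: eq_bigr => y /andP[_ yN].
  rewrite /semigroup; under eq_bigr => z _ do rewrite mulr1.
  by rewrite (kernel_sum1 hK)// mulr1.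
by rewrite exprn_ge0// mulr_ge0.
Qed.

(** At time [n * t] the squared norm of [f] is at most [(2 * e) ^+ (2 * n)] by contraction and at
    least [inner f f / 2 ^+ (n * K)] by slow decay, with steps [t / K]. As [n] grows only the rates
    count, so the size of [inner f f] drops out. *)
Lemma tv_exponential_ge t e f (K : nat) : 0 <= t -> 0 <= e -> (0 < K)%N ->
  (forall x, (x <= N)%N -> tv N (H t x) pi <= e) ->
  \sum_(0 <= y < N.+1) pi y * f y = 0 ->
  (forall y, (y <= N)%N -> `|f y| <= 1) -> 0 < inner f f ->
  4 * t * energy f <= K%:R * inner f f ->
  (2 ^+ K)^-1 <= (2 * e) ^+ 2.
Proof.
move=> t0 e0 K0 he f0 f1 ff ht; rewrite leNgt; apply/negP => lt.
set rho := (2 * e) ^+ 2 * 2 ^+ K.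
have rho1 : `|rho| < 1.
  have rho0 : 0 <= rho by rewrite mulr_ge0 ?sqr_ge0// exprn_ge0.
  by rewrite ger0_norm// /rho -ltr_pdivlMr ?exprn_gt0// div1r.
have KR : 0 < K%:R :> R by rewrite ltr0n.
have bound n : inner f f <= rho ^+ n.
  pose u := t / K%:R.
  have u0 : 0 <= u by rewrite divr_ge0.
  have hu : 2 * (2 * u * energy f) <= inner f f.
    have -> : 2 * (2 * u * energy f) = 4 * t * energy f / K%:R.
      by rewrite /u; field; rewrite gt_eqF.
    by rewrite ler_pdivrMr// [leRHS]mulrC.
  have := geometric_decay (n * K) u0 ff hu.
  have -> : (n * K)%:R * u = n%:R * t by rewrite natrM /u; field; rewrite gt_eqF.
  rewrite ler_pdivrMr ?exprn_gt0// => /le_trans; apply.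
  rewrite /rho exprMn [(n * K)%N]mulnC exprM ler_wpM2r ?exprn_ge0//.
  have -> : ((2 * e) ^+ 2) ^+ n = \sum_(0 <= x < N.+1) pi x * ((2 * e) ^+ 2) ^+ n.
    by rewrite -mulr_suml (bd_sum hK) mul1r.
  rewrite /inner !big_nat.
  apply: ler_sum => x /andP[_ xN]; rewrite -mulrA ler_wpM2l ?(ltW (pi0 xN))//.
  have := tv_iterate n t0 e0 he f0 f1 (xN : (x <= N)%N).
  move: (semigroup _ _ _ _ _) => g hg.
  rewrite -expr2 -real_normK ?num_real// exprAC.
  have q0 : 0 <= (2 * e) ^+ n by rewrite exprn_ge0// mulr_ge0.
  by rewrite ler_sqr// nnegrE.
have /cvgrPdist_lt/(_ _ ff) [n _ /(_ n (leqnn n))] := cvg_expr rho1.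
rewrite sub0r normrN => h.
by have := le_lt_trans (bound n) (le_lt_trans (ler_norm _) h); rewrite ltxx.
Qed.

(* The test function is 1 on [0, i], 0 on [j + 1, N] and linear in the
   resistance coordinate in between. *)
Lemma tv_hardy_ge t e (i j K : nat) : 0 <= t -> 0 <= e -> (0 < K)%N ->
  (i <= j)%N -> (j < N)%N ->
  (forall x, (x <= N)%N -> tv N (H t x) pi <= e) ->
  4 * t <= K%:R * (cdf pi i * (1 - cdf pi j) * resistances p pi i j.+1) ->
  (2 ^+ K)^-1 <= (2 * e) ^+ 2.
Proof.
move=> t0 e0 K0 ij jN he ht.
have r0 k : (k < N)%N -> 0 < resistance p pi k by exact: (resistance_gt0 hK).
set Rij := resistances p pi i j.+1.
have R0 : 0 < Rij.
  rewrite /Rij /resistances big_ltn; last by lia.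
  rewrite ltr_wpDr ?r0//; last by lia.
  by rewrite big_nat sumr_ge0// => k /andP[_ kj]; apply/ltW/r0; lia.
pose g y := potential p pi (fun k => (i <= k)%:R) j.+1 y / Rij.
have g_low y : (y <= i)%N -> g y = 1.
  move=> yi; rewrite /g /potential (big_cat_nat _ (n := i))//=; last by lia.
  rewrite big_nat big1 ?add0r => [|k /andP[_ ki]]; last by rewrite leqNgt ki mulr0.
  rewrite (_ : \sum_(_ <= _ < _) _ = Rij) ?divff ?gt_eqF//.
  by rewrite /Rij /resistances !big_nat; apply: eq_bigr => k /andP[-> _]; rewrite mulr1.
have g_high y : (j < y)%N -> g y = 0.
  by move=> jy; rewrite /g potential_ge// mul0r.
have dg k : (k <= j)%N -> g k - g k.+1 = resistance p pi k * (i <= k)%:R / Rij.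
  by move=> kj; rewrite /g (@potentialS R p pi _ j.+1 k kj); ring.
have g_step k : (k < N)%N -> g k.+1 <= g k.
  move=> kN; have [kj|jk] := leqP k j; last by rewrite !g_high// ltnW.
  rewrite -subr_ge0 dg// divr_ge0 ?(ltW R0)// mulr_ge0//; exact/ltW/r0.
have g01 y : (y <= N)%N -> 0 <= g y <= 1.
  move=> yN; apply/andP; split.
    rewrite /g divr_ge0 ?(ltW R0)//; apply: (potential_ge0 hK) => //.
  elim: y yN => [|y IH] yN; first by rewrite g_low.
  exact: le_trans (g_step y yN) (IH (ltnW yN)).
pose c := \sum_(0 <= y < N.+1) pi y * g y.
have c01 : 0 <= c <= 1.
  apply/andP; split.
    rewrite /c big_nat sumr_ge0// => y /andP[_ yN].
    by rewrite mulr_ge0 ?(ltW (pi0 yN))//; have /andP[] := g01 y yN.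
  rewrite /c -(bd_sum hK) !big_nat; apply: ler_sum => y /andP[_ yN].
  by rewrite ler_piMr ?(ltW (pi0 yN))//; have /andP[] := g01 y yN.
pose f y := g y - c.
have f0 : \sum_(0 <= y < N.+1) pi y * f y = 0.
  under eq_bigr => y _ do rewrite mulrBr.
  by rewrite sumrB -mulr_suml (bd_sum hK) mul1r subrr.
have f1 y : (y <= N)%N -> `|f y| <= 1.
  move=> yN; have /andP[a b] := g01 y yN; have /andP[a' b'] := c01.
  by rewrite ler_norml /f; apply/andP; split; lra.
set a := cdf pi i; set b := 1 - cdf pi j.
have a0 : 0 < a by apply: (cdf_pi_gt0 hK); lia.
have bE : b = \sum_(j.+1 <= y < N.+1) pi y.
  by rewrite /b -(bd_sum hK) (sum_split _ (ltnW jN)); ring.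
have b0 : 0 < b.
  rewrite bE big_nat_recr//= ltr_wpDl ?pi0//.
  by rewrite big_nat sumr_ge0// => k /andP[_ kN]; apply/ltW/pi0; lia.
have ab1 : a + b <= 1.
  have : cdf pi i <= cdf pi j by apply: (cdf_pi_le hK) => //; exact: ltnW.
  by rewrite /a /b; lra.
(* [f] is [1 - c] on mass [a] and [- c] on mass [b]; the minimum over [c] of
   [a * (1 - c)^2 + b * c^2] is [a * b / (a + b)], and [a + b <= 1]. *)
have var : a * b <= inner f f.
  apply: le_trans (_ : a * (1 - c) ^+ 2 + b * c ^+ 2 <= _).
    have sq := sqr_ge0 (a * (1 - c) - b * c).
    have nn : 0 <= a * (1 - c) ^+ 2 + b * c ^+ 2.
      by rewrite addr_ge0// mulr_ge0 ?sqr_ge0// ltW.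
    apply: le_trans (_ : (a + b) * (a * (1 - c) ^+ 2 + b * c ^+ 2) <= _).
      by move: sq; lra.
    by rewrite ler_piMl.
  rewrite /inner (sum_split _ (ltnW jN)); apply: lerD.
    rewrite /cdf (big_cat_nat _ (n := i.+1) (p := j.+1))//= -[leLHS]addr0 lerD//.
      rewrite /a /cdf mulr_suml !big_nat; apply: ler_sum => y /andP[_ yi].
      by rewrite /f g_low// expr2 mulrA.
    rewrite big_nat sumr_ge0// => y /andP[_ yj].
    rewrite -mulrA -expr2 mulr_ge0 ?sqr_ge0//; apply/ltW/pi0/(leq_trans yj).
    exact: ltnW.
  rewrite bE mulr_suml !big_nat; apply: ler_sum => y /andP[jy yN].
  by rewrite /f g_high// sub0r -mulrA mulrNN -expr2.
have ff : 0 < inner f f by apply: lt_le_trans var; rewrite mulr_gt0.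
(* The effective conductance of the path: the drop across edge [k] is its share
   [resistance k / Rij]. *)
have en : energy f = Rij^-1.
  rewrite /energy (big_cat_nat _ (n := j.+1))//=.
  rewrite [X in _ + X]big_nat [X in _ + X]big1 ?addr0 => [|k /andP[jk _]]; last first.
    by rewrite /f !g_high//; [rewrite subrr expr0n mulr0|exact: leqW].
  have -> : Rij^-1 = \sum_(i <= k < j.+1) resistance p pi k / Rij ^+ 2.
    by rewrite -mulr_suml -/(resistances p pi i j.+1) -/Rij; field; rewrite gt_eqF.
  rewrite (big_cat_nat _ (n := i))//=; last exact: leqW.
  rewrite [X in X + _]big_nat big1 ?add0r => [|k /andP[_ ki]]; last first.
    rewrite /f !g_low//; last exact: ltnW.
    by rewrite subrr expr0n mulr0.
  rewrite !big_nat; apply: eq_bigr => k /andP[ik kj].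
  have kN : (k < N)%N := leq_trans kj jN.
  have -> : f k.+1 - f k = - (resistance p pi k / Rij).
    by rewrite -[resistance _ _ _]mulr1 -[1]/(true%:R) -ik -dg// /f; ring.
  move: R0; clearbody Rij => R0.
  rewrite /resistance; have /gt_eqF h1 := pi0 (ltnW kN : (k < N.+1)%N).
  have /gt_eqF h2 := bd_p hK kN; have /gt_eqF h3 := R0.
  by field; rewrite h1 h2 h3.
apply: (@tv_exponential_ge t e f K) => //.
rewrite en ler_pdivrMr//; apply: le_trans ht _.
by rewrite -[leRHS]mulrA ler_wpM2l// ler_wpM2r// ltW.
Qed.

End Relaxation.

(** * Heat kernel of a transition matrix *)

Section MatrixExponential.
Variables (R : realType) (N : nat).
Implicit Types (A : 'M[R]_N.+1) (t x : R) (c : nat -> R).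

Lemma cvg_pseries_factorial c (D S x : R) : 0 <= S ->
  (forall k, `|c k| <= D * S ^+ k / k`!%:R) -> cvgn (pseries c x).
Proof.
move=> S0 hc; apply: normed_cvg.
apply: (@series_le_cvg _ _ (fun k => D * exp_coeff (S * `|x|) k)).
- by move=> k /=.
- move=> k /=; have := hc k; have := normr_ge0 (c k) => h1 h2.
  rewrite /exp_coeff/= mulrA; apply: divr_ge0 => //.
  have : 0 <= D * S ^+ k.
    by have := le_trans h1 h2; rewrite pmulr_lge0// invr_gt0 ltr0n fact_gt0.
  by rewrite exprMn mulrA => h; rewrite mulr_ge0// exprn_ge0.
- move=> k /=; rewrite normrM normrX /exp_coeff/= exprMn.
  have -> : D * (S ^+ k * `|x| ^+ k / k`!%:R) = D * S ^+ k / k`!%:R * `|x| ^+ k by ring.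
  by rewrite ler_wpM2r// exprn_ge0.
exact: (@is_cvg_seriesZ _ _ D (is_cvg_series_exp_coeff _)).
Qed.

Lemma cvg_sum_seq (I : Type) (r : seq I) (u : I -> nat -> R) (l : I -> R) :
  (forall i, u i @ \oo --> l i) ->
  (fun n => \sum_(i <- r) u i n) @ \oo --> \sum_(i <- r) l i.
Proof.
move=> h; elim: r => [|i r IH].
  by rewrite big_nil; under eq_fun do rewrite big_nil; exact: cvg_cst.
by rewrite big_cons; under eq_fun do rewrite big_cons; exact: cvgD.
Qed.

(** Entrywise, [exp(t A)] is a power series in the scalar [t], to which termwise differentiation of
    real series applies. *)
Definition mxexp_coeff A (i j : 'I_N.+1) (k : nat) : R := (A ^+ k) i j / k`!%:R.

Lemma mxexp_pseries t A i j : mxexp (t *: A) i j = limn (pseries (mxexp_coeff A i j) t).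
Proof.
rewrite /mxexp mxE; congr (limn _); congr series; apply/funext => k.
by rewrite exprZn mxE /mxexp_coeff /=; ring.
Qed.

Lemma mx_power_le A i j k : `|(A ^+ k) i j| <= (\sum_i \sum_j `|A i j|) ^+ k.
Proof.
set S := \sum_i _.
have row i' : \sum_l `|A i' l| <= S.
  rewrite /S [leRHS](bigD1 i')//= lerDl; apply: sumr_ge0 => l _.
  exact: sumr_ge0.
have S0 : 0 <= S by apply: sumr_ge0 => l _; apply: sumr_ge0.
elim: k i j => [|k IH] i j.
  by rewrite !expr0 mxE; case: (i == j); rewrite ?normr1 ?normr0.
rewrite exprS mxE; apply: le_trans (ler_norm_sum _ _ _) _.
apply: le_trans (_ : (\sum_l `|A i l|) * S ^+ k <= _).
  rewrite mulr_suml; apply: ler_sum => l _.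
  by rewrite normrM ler_wpM2l.
by rewrite exprS ler_wpM2r// exprn_ge0.
Qed.

Lemma diffs_mxexp_coeff A i j :
  pseries_diffs (mxexp_coeff A i j) = fun k => (A ^+ k.+1) i j / k`!%:R.
Proof.
apply/funext => k; rewrite /pseries_diffs /mxexp_coeff factS natrM.
by rewrite invfM mulrCA mulVKf// pnatr_eq0.
Qed.

(** Termwise differentiation asks for convergence of the series and of its first two derived series,
    [m = 0, 1, 2]. *)
Lemma cvg_mxexp_shift A i j m x :
  cvgn (pseries (fun k => (A ^+ (k + m)) i j / k`!%:R) x).
Proof.
pose S := \sum_i \sum_j `|A i j|.
have S0 : 0 <= S by apply: sumr_ge0 => l _; apply: sumr_ge0.
apply: (@cvg_pseries_factorial _ (S ^+ m) S) => // k.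
rewrite normrM [X in _ * X]ger0_norm ?invr_ge0//.
rewrite ler_pM2r ?invr_gt0 ?ltr0n ?fact_gt0// -exprD addnC.
by have := mx_power_le A i j (m + k); rewrite -/S.
Qed.

Lemma is_derive_mxexp A i j t :
  is_derive t 1 (fun s => mxexp (s *: A) i j) (\sum_l A i l * mxexp (t *: A) l j).
Proof.
under [X in is_derive _ _ X _]funext => s do rewrite mxexp_pseries.
have e0 : mxexp_coeff A i j = fun k => (A ^+ (k + 0)) i j / k`!%:R.
  by apply/funext => k; rewrite addn0.
have e1 : pseries_diffs (mxexp_coeff A i j) = fun k => (A ^+ (k + 1)) i j / k`!%:R.
  by rewrite diffs_mxexp_coeff; apply/funext => k; rewrite addn1.
have e2 : pseries_diffs (pseries_diffs (mxexp_coeff A i j)) =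
    fun k => (A ^+ (k + 2)) i j / k`!%:R.
  rewrite diffs_mxexp_coeff; apply/funext => k; rewrite addn2.
  by rewrite /pseries_diffs factS natrM invfM mulrCA mulVKf// pnatr_eq0.
have c0 x : cvgn (pseries (mxexp_coeff A i j) x) by rewrite e0; exact: cvg_mxexp_shift.
have c1 x : cvgn (pseries (pseries_diffs (mxexp_coeff A i j)) x).
  by rewrite e1; exact: cvg_mxexp_shift.
have c2 x : cvgn (pseries (pseries_diffs (pseries_diffs (mxexp_coeff A i j))) x).
  by rewrite e2; exact: cvg_mxexp_shift.
have lt : `|t| < `| `|t| + 1 |.
  by rewrite [ltRHS]ger0_norm ?addr_ge0// ltrDl.
apply: (is_derive_eq (pseries_snd_diffs (c0 _) (c1 _) (c2 _) lt)).
apply: cvg_lim => //.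
rewrite [X in X @ _ --> _](_ : _ =
   fun n => \sum_l A i l * pseries (mxexp_coeff A l j) t n); last first.
  apply/funext => n; rewrite /pseries /series/= diffs_mxexp_coeff.
  under [RHS]eq_bigr => l _ do rewrite mulr_sumr.
  rewrite exchange_big/=; apply: eq_bigr => k _.
  rewrite exprS mxE mulr_suml mulr_suml; apply: eq_bigr => l _.
  by rewrite /mxexp_coeff !mulrA.
apply: cvg_sum_seq => l; apply: cvgMr; rewrite mxexp_pseries.
suff : cvgn (pseries (mxexp_coeff A l j) t) by [].
have -> : mxexp_coeff A l j = fun k => (A ^+ (k + 0)) l j / k`!%:R.
  by apply/funext => k; rewrite addn0.
exact: cvg_mxexp_shift.
Qed.

Lemma mxexp0 A i j : mxexp (0 *: A) i j = (i == j)%:R.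
Proof.
rewrite mxexp_pseries; apply: lim_near_cst => //.
near=> n; rewrite /pseries /series/=.
have n0 : (0 < n)%N by near: n; exact: nbhs_infty_gt.
rewrite -[n]prednK// big_nat_recl//= big1 ?addr0 => [|k _]; last first.
  by rewrite expr0n mulr0.
by rewrite /mxexp_coeff !expr0 mxE fact0 divr1 mulr1.
Unshelve. all: by end_near.
Qed.

End MatrixExponential.

(** * Transition matrices as birth-and-death kernels *)

Section Bridge.
Variables (R : realType) (N : nat) (P : 'M[R]_N.+1) (pi : 'rV[R]_N.+1).
Hypotheses (hN : (0 < N)%N) (hP : irreducible_birth_death P)
  (hpi : stationary_distribution P pi).

(** [inord] sends an out-of-range index to [ord0], hence the explicit zeros of both rates beyond the
    ends. *)
Definition birth_rate k : R := if (k < N)%N then P (inord k) (inord k.+1) else 0.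
Definition death_rate k : R := if (0 < k <= N)%N then P (inord k) (inord k.-1) else 0.
Definition weight k : R := pi 0 (inord k).
Definition heat t x y : R := heat_kernel P t (inord x) (inord y).

Let P_ge0 x y : 0 <= P x y. Proof. by have [[h _] _ _] := hP; exact: h. Qed.
Let P_sum1 x : \sum_y P x y = 1. Proof. by have [[_ h] _ _] := hP; exact: h. Qed.

Lemma sum_inord (f : 'I_N.+1 -> R) :
  \sum_i f i = \sum_(0 <= k < N.+1) f (inord k).
Proof. by rewrite big_mkord; apply: eq_bigr => i _; rewrite inord_val. Qed.

Lemma generator_matrix (f : nat -> R) k : (k <= N)%N ->
  \sum_l (P - 1%:M) (inord k) l * f l = generator birth_rate death_rate f k.
Proof.
move=> kN.
have -> : \sum_l (P - 1%:M) (inord k) l * f l = \sum_l P (inord k) l * (f l - f k).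
  under eq_bigr => l _ do rewrite !mxE mulrBl.
  rewrite sumrB; under [RHS]eq_bigr => l _ do rewrite mulrBr.
  rewrite sumrB -[X in _ = _ - X]mulr_suml P_sum1 mul1r; congr (_ - _).
  rewrite (bigD1 (inord k))//= eqxx mul1r inordK// big1 ?addr0// => l.
  by rewrite eq_sym => /negPf ->; rewrite mul0r.
rewrite sum_inord.
have -> : \sum_(0 <= l < N.+1) P (inord k) (inord l) * (f (inord l : 'I_N.+1) - f k) =
    \sum_(0 <= l < N.+1) ((l == k.+1)%:R * (birth_rate k * (f l - f k)) +
       (l == k.-1)%:R * (death_rate k * (f l - f k))).
  rewrite !big_nat; apply: eq_bigr => l /andP[_ lN]; rewrite inordK//.
  rewrite /birth_rate /death_rate.
  have [el|l1] := eqVneq l k.+1.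
    move: lN; rewrite el ltnS => kN'; rewrite kN'.
    rewrite (_ : (k.+1 == k.-1) = false); last by apply/negbTE/eqP; clear; lia.
    by rewrite mul0r addr0 mul1r.
  rewrite mul0r add0r; have [->|l2] := eqVneq l k.-1.
    rewrite mul1r kN andbT; case: ltnP => // h.
    have k0 : k = 0%N by clear -h; lia.
    by rewrite k0 subrr !mulr0.
  rewrite mul0r; have [->|lk] := eqVneq l k; first by rewrite subrr mulr0.
  have [_ nn _] := hP; rewrite nn ?mul0r// !inordK//.
  by clear -l1 l2 lk; lia.
rewrite big_split/= /generator; congr (_ + _); last first.
  exact: (sum_delta (fun l => death_rate k * (f l - f k)) (leq_trans (leq_pred k) kN)).
have [kN'|Nk] := ltnP k N.
  exact: (sum_delta (fun l => birth_rate k * (f l - f k)) kN').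
rewrite /birth_rate ltnNge Nk mul0r big_nat big1// => l /andP[_ lN].
by rewrite mul0r mulr0.
Qed.

Lemma power_closed (S : pred 'I_N.+1) :
  (forall x y, S x -> ~~ S y -> P x y = 0) ->
  forall k x y, S x -> ~~ S y -> (P ^+ k) x y = 0.
Proof.
move=> hS; elim=> [|k IH] x y Sx Sy.
  by rewrite expr0 mxE; case: eqVneq Sy => // <-; rewrite Sx.
rewrite exprS mxE big1// => l _.
have [Sl|Sl] := boolP (S l); first by rewrite IH// mulr0.
by rewrite hS// mul0r.
Qed.

(** If the only possible exit from [S] had probability zero, [S] would be closed and no power of [P]
    could lead from [x] to [y]. *)
Lemma crossing_gt0 (S : pred 'I_N.+1) (x y : 'I_N.+1) : S x -> ~~ S y ->
  (forall a b, S a -> ~~ S b -> (a, b) != (x, y) -> P a b = 0) -> 0 < P x y.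
Proof.
move=> Sx Sy h; rewrite lt0r P_ge0 andbT; apply/negP => /eqP Pxy.
have [_ _ /(_ x y) [k]] := hP.
rewrite (@power_closed S) ?ltxx// => a b Sa Sb.
by have [[-> ->]//|ab] := eqVneq (a, b) (x, y); exact: h.
Qed.

Lemma birth_rate_gt0 k : (k < N)%N -> 0 < birth_rate k.
Proof.
move=> kN; rewrite /birth_rate kN.
apply: (@crossing_gt0 (fun i => i <= k)%N).
- by rewrite inordK// ltnS ltnW.
- by rewrite inordK// ltnn.
move=> a b ak kb ab; have [_ nn _] := hP; apply: nn.
have : ~ ((a : nat) = k /\ (b : nat) = k.+1).
  move=> [ea eb]; move/eqP: ab; apply.
  by congr pair; apply: val_inj; rewrite /= ?inordK// ltnW.
by clear -ak kb; lia.
Qed.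

Lemma death_rate_gt0 k : (0 < k <= N)%N -> 0 < death_rate k.
Proof.
move=> /andP[k0 kN]; rewrite /death_rate k0 kN/=.
have kN' : (k.-1 < N.+1)%N by rewrite ltnS (leq_trans (leq_pred _)).
apply: (@crossing_gt0 (fun i => k <= i)%N).
- by rewrite inordK.
- by rewrite inordK// -ltnNge prednK.
move=> a b ak kb ab; have [_ nn _] := hP; apply: nn.
have : ~ ((a : nat) = k /\ (b : nat) = k.-1).
  move=> [ea eb]; move/eqP: ab; apply.
  by congr pair; apply: val_inj; rewrite /= ?inordK// ltnW.
by clear -ak kb k0; lia.
Qed.

Lemma stationary_generator (f : nat -> R) :
  \sum_(0 <= x < N.+1) weight x * generator birth_rate death_rate f x = 0.
Proof.
rewrite big_nat; under eq_bigr => x /andP[_ xN] do rewrite -(generator_matrix f xN).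
rewrite -big_nat -(sum_inord (fun x => pi 0 x * \sum_l (P - 1%:M) x l * f l)).
under eq_bigr => x _ do rewrite mulr_sumr.
rewrite exchange_big/= big1// => l _.
have [_ _ e] := hpi.
have -> : \sum_x pi 0 x * ((P - 1%:M) x l * f l) = (pi *m (P - 1%:M)) 0 l * f l.
  by rewrite mxE mulr_suml; apply: eq_bigr => x _; rewrite mulrA.
by rewrite mulmxBr mulmx1 e subrr mxE mul0r.
Qed.

(** Stationarity tested on the indicator of [[0, k]]: only the flow across the edge [(k, k+1)]
    survives, and it must balance. *)
Lemma weight_reversible k : (k < N)%N ->
  weight k * birth_rate k = weight k.+1 * death_rate k.+1.
Proof.
move=> kN; have := stationary_generator (fun x => (x <= k)%:R).
have -> : \sum_(0 <= x < N.+1) weight x *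
    generator birth_rate death_rate (fun x => (x <= k)%:R) x =
  \sum_(0 <= x < N.+1) ((x == k)%:R * (- (weight x * birth_rate x)) +
     (x == k.+1)%:R * (weight x * death_rate x)).
  apply: eq_bigr => x _; rewrite /generator.
  have [->|xk] := eqVneq x k.
    rewrite ltnn leqnn (leq_trans (leq_pred _))// (_ : (k == k.+1) = false).
      by rewrite subrr sub0r mulr0 addr0 mul0r addr0 mulrN1 mulrN mul1r.
    by apply/negbTE/eqP; clear; lia.
  have [->|xk1] := eqVneq x k.+1.
    rewrite /= ltnn leqnn (_ : (k.+2 <= k)%N = false).
      by rewrite subrr subr0 mulr0 add0r mul0r add0r mulr1 mul1r.
    by clear; lia.
  rewrite (_ : (x.+1 <= k)%N = (x <= k)%N); last by clear -xk; lia.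
  rewrite (_ : (x.-1 <= k)%N = (x <= k)%N); last by clear -xk xk1; lia.
  by rewrite subrr !mulr0 !mul0r addr0 mulr0.
rewrite big_split/= (sum_delta (fun x => - (weight x * birth_rate x)) (ltnW kN)).
rewrite (sum_delta (fun x => weight x * death_rate x) kN).
by move/eqP; rewrite addrC subr_eq0 => /eqP.
Qed.

Lemma weight_sum1 : \sum_(0 <= k < N.+1) weight k = 1.
Proof. by have [_ h _] := hpi; rewrite -h sum_inord. Qed.

(** Detailed balance carries positivity upward from [0]; a zero weight at [0] would spread in the
    same way, against total mass 1. *)
Lemma weight_gt0 k : (k <= N)%N -> 0 < weight k.
Proof.
have w0 j : 0 <= weight j by have [h _ _] := hpi; exact: h.
have step j : (j < N)%N -> 0 < weight j -> 0 < weight j.+1.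
  move=> jN wj; have := mulr_gt0 wj (birth_rate_gt0 jN).
  by rewrite weight_reversible// pmulr_lgt0// death_rate_gt0.
have start : 0 < weight 0.
  rewrite lt0r w0 andbT; apply/negP => /eqP e.
  have z j : (j <= N)%N -> weight j = 0.
    elim: j => // j IH jN; have := weight_reversible jN.
    rewrite IH 1?ltnW// mul0r => /esym/eqP; rewrite mulf_eq0 => /orP[/eqP//|].
    by rewrite gt_eqF// death_rate_gt0.
  have := weight_sum1; rewrite big_nat big1 => [|j /andP[_ jN]]; last exact: z.
  by move/eqP; rewrite eq_sym oner_eq0.
by elim: k => // k IH kN; apply: step => //; exact/IH/ltnW.
Qed.

Lemma bd_kernel_heat : bd_kernel N birth_rate death_rate weight heat.
Proof.
split => //.
- by move=> k; rewrite /birth_rate; case: ifP.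
- by move=> k; rewrite /death_rate; case: ifP.
- move=> k; rewrite /birth_rate /death_rate.
  have row1 (x y : 'I_N.+1) : P x y <= 1.
    by rewrite -(P_sum1 x) (bigD1 y)//= lerDl sumr_ge0.
  case: ifP => kN; last by case: ifP; rewrite add0r.
  case: ifP => [/andP[k0 _]|_]; last by rewrite addr0.
  rewrite -(P_sum1 (inord k)) (bigD1 (inord k.+1))//= lerD2l.
  rewrite (bigD1 (inord k.-1))/=; first by rewrite lerDl sumr_ge0.
  apply/eqP => /(congr1 val)/=; rewrite !inordK//; clear -k0 kN; lia.
- exact: birth_rate_gt0.
- by rewrite /birth_rate ltnn.
- exact: weight_gt0.
- exact: weight_sum1.
- exact: weight_reversible.
- move=> x y xN yN; rewrite /heat /heat_kernel mxexp0; congr (_%:R).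
  by congr nat_of_bool; apply/eqP/eqP => [/(congr1 val)/=|->//]; rewrite !inordK.
- move=> x y t xN yN; apply: (is_derive_eq (is_derive_mxexp _ _ _ _)).
  rewrite -(generator_matrix (fun z => heat t z y) xN).
  by apply: eq_bigr => l _; rewrite /heat inord_val.
Qed.

End Bridge.

(** * Cutoff and the product condition *)

Section CutoffCriterion.
Variable R : realType.
Implicit Types (S : R -> set R) (B T c w e t K : R).

(** What the two distances share. [S e] is the set of times at distance at most [e], [c] the
    location of the cutoff, [w] the window and [B] the relaxation scale; [T] is comparable to
    [c]. *)
Record cutoff_scales (C : R -> R) S B T c w : Prop := CutoffScales {
  sc_B : 0 < B;
  sc_BT : B <= T;
  sc_w0 : 0 <= w;
  sc_w : w ^+ 2 = B * T;
  sc_cT : c <= T;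
  sc_Tc : T <= 2 * c;
  sc_ge0 : forall e t, S e t -> 0 <= t;
  sc_mono : forall e e' t, e <= e' -> S e t -> S e' t;
  sc_upper : forall e, 0 < e < 1 -> S e (c + C e * w);
  sc_lower : forall e t, 0 < e < 1 -> S (1 - e) t -> c - C e * w <= t;
  sc_relax : forall (k : nat) t, (0 < k)%N -> S (2 ^+ (2 * k + 2))^-1 t -> k%:R * B <= t
}.

Variables (C : R -> R) (S : nat -> R -> set R) (B T c w : nat -> R).
Hypothesis C0 : forall e, 0 <= C e.
Hypothesis hS : forall n, cutoff_scales C (S n) (B n) (T n) (c n) (w n).

Let T0 n : 0 < T n. Proof. exact: lt_le_trans (sc_B (hS n)) (sc_BT (hS n)). Qed.
Let c0 n : 0 < c n. Proof. by have := T0 n; have := sc_Tc (hS n); lra. Qed.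

Lemma inf_upper n e : 0 < e < 1 -> inf (S n e) <= c n + C e * w n.
Proof.
move=> he; apply: ge_inf; last exact: (sc_upper (hS n)).
by exists 0 => t /(sc_ge0 (hS n)).
Qed.

Lemma inf_lower n e : 0 < e < 1 -> c n - C (1 - e) * w n <= inf (S n e).
Proof.
move=> he; apply: lb_le_inf; first by exists (c n + C e * w n); exact: (sc_upper (hS n)).
move=> t St; apply: (sc_lower (hS n)); first by lra.
by rewrite subKr.
Qed.

(** From [w^2 = B T] and [T <= 2 c], the ratio [w / c] vanishes as [T / B] grows, while both infima
    lie within a constant multiple of [w] of [c]. *)
Lemma cutoff_window : (forall K, \forall n \near \oo, K * B n <= T n) ->
  cutoff (fun n e => inf (S n e)).
Proof.
move=> hT e he; apply/cvgrPdist_lt => eps eps0.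
pose a := C e + C (1 - e).
have a0 : 0 <= a by rewrite addr_ge0.
(* Capping the tolerance at 1 also keeps the denominator above [c n / 2]. *)
pose m := Num.min 1 eps.
have m0 : 0 < m by rewrite lt_min ltr01.
have m1 : m <= 1 by rewrite ge_min lexx.
have meps : m <= eps by rewrite ge_min lexx orbT.
pose eta := m / (8 * (a + 1)).
have den : 0 < 8 * (a + 1) by lra.
have eta0 : 0 < eta by rewrite divr_gt0.
have aeta : 8 * (a * eta) <= m.
  rewrite /eta (_ : 8 * (a * (m / (8 * (a + 1)))) = m * (a / (a + 1))).
    by rewrite ler_piMr ?(ltW m0)// ler_pdivrMr; lra.
  by field; rewrite !gt_eqF//; lra.
near=> n.
have TB : 4 / eta ^+ 2 * B n <= T n by near: n; exact: hT.
have [hB hBT hw0 hw hcT hTc _ _ _ _ _] := hS n.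
have wc : w n <= eta * c n.
  rewrite -(@ler_pXn2r _ 2)// ?nnegrE//; last by rewrite mulr_ge0 ?ltW.
  rewrite hw exprMn.
  have : 4 * B n <= eta ^+ 2 * T n.
    by move: TB; rewrite mulrAC ler_pdivrMr ?exprn_gt0// [leRHS]mulrC.
  move: (sqr_ge0 eta) (T0 n) (c0 n); set h := eta ^+ 2 => h0 t0 cc h1.
  have h2 : 4 * B n * T n <= h * T n * T n by rewrite ler_pM2r.
  have h3 : h * (T n * T n) <= h * (2 * c n * (2 * c n)).
    by rewrite ler_wpM2l// ler_pM// ltW.
  by rewrite expr2; lra.
have he' : 0 < 1 - e < 1 by lra.
have u1 := inf_upper n he; have l1 := inf_lower n he.
have u2 := inf_upper n he'; have l2 := inf_lower n he'; rewrite subKr in l2.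
have awc : a * w n <= m / 8 * c n.
  apply: le_trans (ler_wpM2l a0 wc) _.
  by rewrite mulrA ler_wpM2r ?(ltW (c0 n))//; lra.
have Cw : 0 <= C e * w n by rewrite mulr_ge0.
have Cw' : 0 <= C (1 - e) * w n by rewrite mulr_ge0.
have aw : a * w n = C e * w n + C (1 - e) * w n by rewrite /a mulrDl.
have mc : m * c n <= c n by rewrite ler_piMl ?(ltW (c0 n)).
set x := inf (S n e) in u1 l1 *; set y := inf (S n (1 - e)) in u2 l2 *.
have cn0 := c0 n.
have y0 : 0 < y by lra.
rewrite (_ : 1 - x / y = (y - x) / y); last by field; rewrite gt_eqF.
rewrite normrM normfV (gtr0_norm y0) ltr_pdivrMr//.
apply: lt_le_trans (_ : m * y <= _); last by rewrite ler_wpM2r// ltW.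
have my : m * (c n / 2) <= m * y by rewrite ler_wpM2l ?(ltW m0)//; lra.
have mc0 : 0 < m * c n by rewrite mulr_gt0.
by rewrite ltr_norml; apply/andP; split; lra.
Unshelve. all: by end_near.
Qed.

(** For tiny [e] the numerator is at least [k' * B], whereas the denominator is at most the time for
    level [1/2], itself at most [C1 * T]. A ratio below 2 gives [k' * B <= 2 * C1 * T], and [k'] is
    arbitrary. *)
Lemma cutoff_product_condition : cutoff (fun n e => inf (S n e)) ->
  forall K, \forall n \near \oo, K * B n <= T n.
Proof.
move=> hcut K.
pose C1 := 1 + C 2^-1.
have C10 : 0 < C1 by rewrite ltr_wpDr.
have [k hk] : exists k : nat, 2 * C1 * K <= k%:R.
  by exists (Num.truncn (2 * C1 * K)).+1; exact/ltW/truncnS_gt.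
pose k' := k.+1.
pose e : R := (2 ^+ (2 * k' + 2))^-1.
have e0 : 0 < e by rewrite invr_gt0 exprn_gt0.
have e2 : e <= 2^-1.
  rewrite /e lef_pV2 ?posrE ?exprn_gt0// -[leLHS]expr1 ler_eXn2l ?ltr1n//; lia.
have he : 0 < e < 1 by rewrite e0/=; lra.
have /cvgrPdist_lt/(_ 2^-1) := hcut e he.
have -> : (0 < 2^-1 :> R) by rewrite invr_gt0.
move=> /(_ isT) near_ratio.
near=> n.
have : `|1 - inf (S n e) / inf (S n (1 - e))| < 2^-1 by near: n.
have [hB hBT hw0 hw hcT hTc ge0 mono upper lower relax] := hS n.
have x_ge : k'%:R * B n <= inf (S n e).
  apply: lb_le_inf; first by eexists; exact: (upper e he).
  by move=> t; exact: relax.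
have y_le : inf (S n (1 - e)) <= C1 * T n.
  apply: (@le_trans _ _ (c n + C 2^-1 * w n)).
    apply: ge_inf; first by exists 0 => t /ge0.
    by apply: (mono 2^-1); [lra|apply: upper; lra].
  have wT : w n <= T n.
    rewrite -(@ler_pXn2r _ 2)// ?nnegrE// ?(ltW (T0 n))//.
    by rewrite hw expr2 ler_pM2r.
  by rewrite /C1 mulrDl mul1r lerD// ler_wpM2l.
have y_ge : 0 <= inf (S n (1 - e)).
  apply: lb_le_inf; first by eexists; apply: (upper (1 - e)); lra.
  by move=> t; exact: ge0.
set x := inf (S n e) in x_ge *; set y := inf (S n (1 - e)) in y_le y_ge *.
rewrite ltr_norml => /andP[h1 h2].
(* With [y = 0] the ratio is 0 by convention, at distance 1 from the limit. *)
have yp : 0 < y.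
  rewrite lt0r y_ge andbT; apply/negP => /eqP ey.
  by move: h2; rewrite ey invr0 mulr0; lra.
have : x / y < 2 by lra.
rewrite ltr_pdivrMr// => xy.
have hk' : 2 * C1 * K <= k'%:R by apply: le_trans hk _; rewrite ler_nat.
have : 2 * C1 * K * B n <= k'%:R * B n by rewrite ler_pM2r.
move=> h3; rewrite -(ler_pM2l C10) mulrA; lra.
Unshelve. all: by end_near.
Qed.

End CutoffCriterion.

(** * The Muckenhoupt constant against the mean hitting times *)

Section Scales.
Variables (R : realType) (N : nat) (p q pi : nat -> R) (H : R -> nat -> nat -> R).
Hypothesis hK : bd_kernel N p q pi H.
Implicit Types (t e d B T w : R) (x y k m : nat).

Lemma hardy_constant : exists B : R, exists i j : nat,
  [/\ (i <= j)%N, (j < N)%N,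
      B = cdf pi i * (1 - cdf pi j) * resistances p pi i j.+1 &
      forall i' j', (i' <= j')%N -> (j' < N)%N ->
        cdf pi i' * (1 - cdf pi j') * resistances p pi i' j'.+1 <= B].
Proof.
have N0 := bd_N hK.
pose F (ij : 'I_N * 'I_N) :=
  cdf pi ij.1 * (1 - cdf pi ij.2) * resistances p pi ij.1 ij.2.+1.
pose o := (Ordinal N0, Ordinal N0).
have [ij ij_le hmax] := @arg_maxP _ R ('I_N * 'I_N)%type o
  (fun ij => ij.1 <= ij.2)%N F (leqnn _).
exists (F ij), ij.1, ij.2; split => // i' j' ij' jN'.
exact: (hmax (Ordinal (leq_ltn_trans ij' jN'), Ordinal jN')).
Qed.

Lemma median : exists m, [/\ (m <= N)%N, 2^-1 <= cdf pi m &
  forall k, (k < m)%N -> cdf pi k <= 2^-1].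
Proof.
have [|m [mN h1 h2]] := @quantile _ _ _ _ _ _ hK 2^-1; first by lra.
by exists m; split => // k /h2/ltW.
Qed.

Lemma hardy_gt0 i j : (i <= j)%N -> (j < N)%N ->
  0 < cdf pi i * (1 - cdf pi j) * resistances p pi i j.+1.
Proof.
move=> ij jN; have iN := leq_trans ij (ltnW jN).
rewrite !mulr_gt0 ?(cdf_pi_gt0 hK)//.
  rewrite subr_gt0 -(bd_sum hK) (sum_split _ (ltnW jN)) ltrDl big_nat_recr//=.
  rewrite ltr_wpDl ?(bd_pi hK)// big_nat sumr_ge0// => k /andP[_ kN].
  exact/ltW/(bd_pi hK)/ltnW.
rewrite /resistances big_nat_recr//= ltr_wpDl ?(resistance_gt0 hK)//.
rewrite big_nat sumr_ge0// => k /andP[_ kj].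
exact/ltW/(resistance_gt0 hK)/(ltn_trans kj).
Qed.

(** For [i <= k <= j], [F(i) (1 - F(j)) <= F(k) (1 - F(k))]. Sum [r_k F(k) (1 - F(k))] over all
    edges, dropping [1 - F(k)] below [m] and [F(k)] from [m] on. *)
Lemma hardy_le_means m i j : (m <= N)%N -> (i <= j)%N -> (j < N)%N ->
  cdf pi i * (1 - cdf pi j) * resistances p pi i j.+1 <=
  start_mean p pi m + end_mean N q pi m.
Proof.
move=> mN ij jN.
have r0 k : (k < N)%N -> 0 < resistance p pi k by exact: (resistance_gt0 hK).
have F0 k : (k < N)%N -> 0 <= cdf pi k by move=> kN; apply/ltW/(cdf_pi_gt0 hK)/ltnW.
have F1 k : (k < N)%N -> 0 <= 1 - cdf pi k.
  by move=> kN; rewrite subr_ge0 (cdf_pi_le1 hK)// ltnW.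
pose h k := resistance p pi k * (cdf pi k * (1 - cdf pi k)).
have h0 k : (k < N)%N -> 0 <= h k.
  by move=> kN; rewrite !mulr_ge0 ?F0 ?F1//; exact/ltW/r0.
apply: (@le_trans _ _ (\sum_(i <= k < j.+1) h k)).
  rewrite /resistances mulr_sumr !big_nat; apply: ler_sum => k /andP[ik kj].
  have kN : (k < N)%N := leq_trans kj jN.
  rewrite mulrC ler_wpM2l ?(ltW (r0 k kN))// ler_pM ?F0 ?F1//.
  - exact: leq_ltn_trans ik kN.
  - by apply: (cdf_pi_le hK) => //; exact: ltnW.
  - by rewrite lerD2l lerN2; apply: (cdf_pi_le hK) => //; exact: ltnW.
apply: (@le_trans _ _ (\sum_(0 <= k < N) h k)).
  rewrite (big_cat_nat _ (n := i) (p := N))//=; last exact/ltnW/(leq_ltn_trans ij).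
  rewrite (big_cat_nat _ (n := j.+1) (p := N))//=; last exact: leqW.
  rewrite addrCA lerDl addr_ge0// big_nat sumr_ge0// => k /andP[a b]; apply: h0 => //.
  exact: leq_trans b (leq_trans ij (ltnW jN)).
rewrite (end_meanE hK mN) /start_mean /hit_mean /potential.
rewrite (big_cat_nat _ (n := m))//=; apply: lerD; rewrite !big_nat; apply: ler_sum.
  move=> k /andP[_ km]; have kN := leq_trans km mN.
  rewrite ler_wpM2l ?(ltW (r0 k kN))// ler_piMr ?F0//.
  by rewrite gerBl F0.
move=> k /andP[_ kN].
rewrite ler_wpM2l ?(ltW (r0 k kN))// ler_piMl ?F1//.
by rewrite (cdf_pi_le1 hK)// ltnW.
Qed.

End Scales.

(** * The two families of mixing times of one chain *)

Section MixingSets.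
Variables (R : realType) (N : nat) (P : 'M[R]_N.+1) (pi : 'rV[R]_N.+1).
Hypotheses (hN : (0 < N)%N) (hP : irreducible_birth_death P)
  (hpi : stationary_distribution P pi).
Implicit Types (t e d : R).

Definition mix_times e : set R := [set t : R | 0 <= t /\
  max_state (fun x => tv_distance (row x (heat_kernel P t)) pi) <= e].

Definition sep_times e : set R := [set t : R | 0 <= t /\
  max_state (fun x => separation (row x (heat_kernel P t)) pi) <= e].

Lemma max_state_le (f : 'I_N.+1 -> R) e :
  max_state f <= e <-> forall x, f x <= e.
Proof.
split => [h x|h]; last by rewrite /max_state; apply/bigmax_leP.
by move: h; rewrite /max_state => /bigmax_leP[_ /(_ x isT)].
Qed.

Lemma forall_inord (Q : 'I_N.+1 -> Prop) :
  (forall i, Q i) <-> (forall k, (k <= N)%N -> Q (inord k)).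
Proof.
split => [h k _|h i]; first exact: h.
by rewrite -(inord_val i); apply: h; rewrite -ltnS.
Qed.

Lemma tv_distance_heat t k :
  tv_distance (row (inord k) (heat_kernel P t)) pi = tv N (heat P t k) (weight pi).
Proof.
rewrite /tv_distance /tv sum_inord; congr (_ * _); apply: eq_bigr => y _.
by rewrite mxE.
Qed.

Lemma mix_timesP e t :
  mix_times e t <-> 0 <= t /\ forall x, (x <= N)%N -> tv N (heat P t x) (weight pi) <= e.
Proof.
rewrite /mix_times/= max_state_le (forall_inord (fun i => _ <= e)).
by split=> -[t0 h]; split => // x xN; have := h x xN; rewrite tv_distance_heat.
Qed.

Lemma sep_timesP e t : sep_times e t <-> 0 <= t /\
  forall x y, (x <= N)%N -> (y <= N)%N -> 1 - heat P t x y / weight pi y <= e.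
Proof.
rewrite /sep_times/= max_state_le (forall_inord (fun i => _ <= e)).
split=> -[t0 h]; split => //.
  move=> x y xN yN; have := h x xN; rewrite /separation max_state_le => /(_ (inord y)).
  by rewrite mxE.
move=> x xN; rewrite /separation max_state_le.
apply/forall_inord => y yN; rewrite mxE; exact: h.
Qed.

Let hK : bd_kernel N (birth_rate P) (death_rate P) (weight pi) (heat P) :=
  bd_kernel_heat hN hP hpi.

(** Separation at most [e] means [H >= (1 - e) pi] pointwise, so [|H - pi| <= H - pi + 2 e pi],
    whose sum is [2 e]. *)
Lemma sep_times_mix e t : 0 <= e -> sep_times e t -> mix_times e t.
Proof.
move=> e0 /sep_timesP[t0 h]; apply/mix_timesP; split => // x xN.
have -> : e = 2^-1 * \sum_(0 <= y < N.+1)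
    (heat P t x y - weight pi y + 2 * e * weight pi y).
  rewrite big_split/= sumrB -mulr_sumr (kernel_sum1 hK)// (bd_sum hK); by field.
rewrite /tv ler_pM2l ?invr_gt0// !big_nat; apply: ler_sum => y /andP[_ yN].
have wy := bd_pi hK (yN : (y <= N)%N).
have := h x y xN yN; rewrite lerBlDr -lerBlDl ler_pdivlMr//.
have := mulr_ge0 e0 (ltW wy).
move: (heat _ _ _ _) (weight _ _) => a b eb hab.
by rewrite ler_norml; apply/andP; split; lra.
Qed.

(** Taking [d = e / 16] keeps the errors, at most [8 * d], strictly below [e]; then
    [8 / d^2 = 2048 / e^2], doubled because separation uses a window at each end. *)
Definition window_constant e : R := 4096 / e ^+ 2.

Lemma window_constant_ge0 e : 0 <= window_constant e.
Proof. by apply: divr_ge0; [exact: ler0n|exact: sqr_ge0]. Qed.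

Lemma cutoff_scales_chain : exists B T c w : R,
  cutoff_scales window_constant mix_times B T c w /\
  cutoff_scales window_constant sep_times B T T w.
Proof.
have [B [i [j [ij jN eB hB]]]] := hardy_constant hK.
have [m [mN m1 m2]] := median hK.
set T0 := start_mean (birth_rate P) (weight pi) m.
set TN := end_mean N (death_rate P) (weight pi) m.
pose T := T0 + TN.
pose w := Num.sqrt (B * T).
have B0 : 0 < B by rewrite eB (hardy_gt0 hK).
have BT : B <= T by rewrite eB (hardy_le_means hK).
have T00 : 0 <= T0 by exact: (start_mean_ge0 hK mN).
have TN0 : 0 <= TN by exact: (end_mean_ge0 hK).
have BT0 : 0 <= B * T by rewrite mulr_ge0// ltW// (lt_le_trans B0).
have w2 : w ^+ 2 = B * T by rewrite sqr_sqrtr.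
have w0 : 0 <= w by rewrite sqrtr_ge0.
have Bw : B <= w.
  by rewrite -(@ler_pXn2r _ 2)// ?nnegrE ?(ltW B0)// w2 expr2 ler_pM2l.
have hs : chain_scales N (birth_rate P) (weight pi) m B (T0 + TN) w.
  by split => //; rewrite -/T ?w2// lerDl.
have d_of e : 0 < e < 1 -> [/\ 0 < e / 16, e / 16 <= 4^-1, e / 16 <= 2^-1 &
    8 / (e / 16) ^+ 2 = window_constant e / 2].
  move=> /andP[e0 e1]; split; [by rewrite divr_gt0|lra|lra|].
  by rewrite /window_constant; field; rewrite gt_eqF.
have wc e : 0 < e < 1 -> 0 <= window_constant e * w.
  by move=> _; apply: mulr_ge0 => //; exact: window_constant_ge0.
have relax (k : nat) t : (0 < k)%N -> mix_times (2 ^+ (2 * k + 2))^-1 t -> k%:R * B <= t.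
  move=> k0 /mix_timesP[t0 ht]; rewrite leNgt; apply/negP => lt.
  have e0 : 0 <= (2 ^+ (2 * k + 2))^-1 :> R by rewrite invr_ge0 exprn_ge0.
  have K0 : (0 < 4 * k)%N by rewrite muln_gt0.
  have := tv_hardy_ge hK t0 e0 K0 ij jN ht.
  rewrite -eB natrM -mulrA ler_pM2l// => /(_ (ltW lt)).
  (* The exponent [2 * k + 2] makes this square a quarter of [2 ^- K] for [K = 4 * k], contradicting
     [tv_hardy_ge]. *)
  have -> : (2 * (2 ^+ (2 * k + 2))^-1) ^+ 2 = (2 ^+ (4 * k))^-1 / 4 :> R.
    rewrite exprD expr2 (_ : (4 * k = 2 * k + 2 * k)%N); last by rewrite -mulnDl.
    by rewrite [in RHS]exprD; field; rewrite expf_neq0.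
  have : 0 < (2 ^+ (4 * k))^-1 :> R by rewrite invr_gt0 exprn_gt0.
  lra.
exists B, T, (Num.max T0 TN), w; split; split => //.
- by rewrite ge_max; apply/andP; split; rewrite /T; lra.
- have := le_max T0 T0 TN; have := le_max TN T0 TN.
  by rewrite !lexx orbT/= /T; lra.
- by move=> e t [].
- by move=> e e' t ee' /mix_timesP[t0 h]; apply/mix_timesP; split => // x xN;
    apply: le_trans (h x xN) ee'.
- move=> e he; have [d0 _ d1 dE] := d_of e he; have := wc e he => cw.
  have := le_max T0 T0 TN; have := le_max TN T0 TN; rewrite !lexx orbT/= => hm1 hm2.
  apply/mix_timesP; split; first by lra.
  move=> x xN; apply: le_trans (tv_worst_le hK hs d0 d1 xN _ _) _.
  + by rewrite -/T0 dE; lra.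
  + by rewrite -/TN dE; lra.
  + by case/andP: he; lra.
- move=> e t he /mix_timesP[t0 h]; rewrite leNgt; apply/negP => lt.
  have [d0 _ d1 dE] := d_of e he; have := wc e he => cw.
  have [|x xN hx] := tv_worst_ge hK hs d0 d1 t0.
    by rewrite -/T0 -/TN dE; lra.
  by have := h x xN; case/andP: he; lra.
- by rewrite mulr2n mulrDl mul1r lerDl (le_trans (ltW B0)).
- by move=> e t [].
- by move=> e e' t ee' /sep_timesP[t0 h]; apply/sep_timesP; split => // x y xN yN;
    apply: le_trans (h x y xN yN) ee'.
- move=> e he; have [d0 _ d1 dE] := d_of e he; have := wc e he => cw.
  apply/sep_timesP; split; first by rewrite addr_ge0// addr_ge0.
  move=> x y xN yN; apply: le_trans (density_worst_ge hK hs d0 d1 xN yN _) _.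
    by rewrite -/T0 -/TN dE -/T; lra.
  by case/andP: he; lra.
- move=> e t he /sep_timesP[t0 h]; rewrite leNgt; apply/negP => lt.
  have [d0 d1 _ dE] := d_of e he; have := wc e he => cw.
  have := density_ends_le hK hs d0 d1 t0.
  rewrite -/T0 -/TN dE -/T => hd.
  have := h 0%N N (leq0n N) (leqnn N); case/andP: he => e0 e1.
  by have : heat P t 0 N / weight pi N <= 8 * (e / 16); [apply: hd; lra|lra].
(* Separation dominates total variation, so it inherits the relaxation bound. *)
- move=> k t k0 /sep_times_mix h; apply: relax => //; apply: h.
  by rewrite invr_ge0 exprn_ge0.
Qed.

End MixingSets.

Theorem corollary5 (R : realType) (N : nat -> nat)
    (P : forall n : nat, 'M[R]_((N n).+1)) (pi : forall n : nat, 'rV[R]_((N n).+1))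
    (hN : forall n : nat, (1 <= N n)%N)
    (hP : forall n : nat, irreducible_birth_death (P n))
    (hpi : forall n : nat, stationary_distribution (P n) (pi n)) :
  cutoff (fun n => t_mix (P n) (pi n)) <-> cutoff (fun n => t_sep (P n) (pi n)).
Proof.
have /choice[f hf] : forall n, exists s : R * R * R * R,
   cutoff_scales (@window_constant R) (mix_times (P n) (pi n)) s.1.1.1 s.1.1.2 s.1.2 s.2 /\
   cutoff_scales (@window_constant R) (sep_times (P n) (pi n)) s.1.1.1 s.1.1.2 s.1.1.2 s.2.
  move=> n; have [B [T [c [w h]]]] := cutoff_scales_chain (hN n) (hP n) (hpi n).
  by exists (B, T, c, w).
have C0 := @window_constant_ge0 R.
have hmix n := (hf n).1; have hsep n := (hf n).2.
(* The condition drawn from either cutoff involves only [B] and [T], which the two families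
   share. *)
split => h.
- exact: (cutoff_window C0 hsep (cutoff_product_condition C0 hmix h)).
- exact: (cutoff_window C0 hmix (cutoff_product_condition C0 hsep h)).
Qed.
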